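(* Let $S=(s_1,s_2,s_3,s_4,\ldots)$ be a packing sequence with $s_1=1$, $s_2=3$ and $s_3=3$. Then a graph $G$ is $4$-$\chi_S$-vertex-critical if and only if $$G\in\{K_4\}\cup\{H_1,H_2,H_3,H_4,H_5,H_7,H_{14},H_{15}\}\cup\mathcal{C}_5\cup\mathcal{C}_6\cup\mathcal{D}_{s_4}\cup\{G_{2k}: k\ge 3\},$$ where $$\mathcal{D}_{s_4}=\{C_n : n\ge 5 \text{ and } (n\equiv 1,2 \bmod 4,\ \text{or}\ (n\equiv 3\bmod 4 \text{ and } s_4<\lfloor n/2\rfloor))\}.$$
   Context: All graphs are finite, simple and undirected; graphs are considered up to isomorphism ($G=H$ and $G\in\mathcal{F}$ are meant up to isomorphism). $d_G(u,v)$ is the length of a shortest $u,v$-path in $G$ (infinite if there is none). $C_n,P_n,K_n$ are the cycle, path and complete graph on $n$ vertices. A packing sequence is a non-decreasing sequence $S=(s_1,s_2,\ldots)$ of positive integers. An $S$-packing $k$-coloring of $G$ is a map $c:V(G)\to\{1,\ldots,k\}$ such that if $u\ne v$ and $c(u)=c(v)=i$, then $d_G(u,v)>s_i$. The $S$-packing chromatic number $\chi_S(G)$ is the smallest $k$ such that $G$ has an $S$-packing $k$-coloring. $G$ is $\chi_S$-vertex-critical if $\chi_S(G-u)<\chi_S(G)$ for every $u\in V(G)$; it is $4$-$\chi_S$-vertex-critical if moreover $\chi_S(G)=4$. For $k\ge 3$, $G_{2k}$ is the graph obtained from the path $P_{2k-2}$ by attaching two pendant vertices to each of the two leaves (end-vertices)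 of $P_{2k-2}$. $\mathcal{C}_5$ (not to be confused with the cycle $C_5$) is the family of the four graphs obtained from the 5-cycle $v_1v_2v_3v_4v_5v_1$ by adding one of the following sets of chords: $\{v_1v_3\}$; $\{v_1v_3,v_1v_4\}$; $\{v_1v_3,v_2v_4\}$; $\{v_1v_4,v_2v_5,v_3v_5\}$ (the last graph is the wheel consisting of a 4-cycle and a vertex adjacent to all its vertices). $\mathcal{C}_6$ is the family of the three graphs obtained from the 6-cycle $v_1v_2v_3v_4v_5v_6v_1$ by adding one, two, or all three of the chords $v_1v_4,v_2v_5,v_3v_6$. The graphs $H_i$ are given by edge sets (vertices are the letters occurring): $H_1$: $ab,bc,cd,da,bd,ae$. $H_2$: $ab,bc,ca,cd,de,ec$. $H_3$: $ab,bc,ca,ad,be,cf$. $H_4$: $ab,bc,ca,bd,de$. $H_5$: $ab,bc,cd,da,bf,ce$. $H_7$: $ab,bc,cd,da,ce,bf,df$. $H_{14}$: $ab,bc,cd,de,cf,dg$. $H_{15}$: $ab,bc,cd,da,ce,ef,eg$. *)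

(* Defs.v *)
From HB Require Import structures.
From mathcomp Require Import all_boot.

Set Implicit Arguments.
Unset Strict Implicit.
Unset Printing Implicit Defensive.

Record sgraph := SGraph {
  vertex :> finType;
  adj : rel vertex;
  adj_sym : symmetric adj;
  adj_irr : irreflexive adj }.
Arguments adj {s} x y : rename.

Definition graph_iso (G H : sgraph) : Prop :=
  exists2 f : G -> H, bijective f & {mono f : x y / adj x y}.

Section Distance.
Variable G : sgraph.

(* The path [u :: p] has [n] edges. *)
Definition joined_by (u v : G) (n : nat) : bool :=
  [exists p : n.-tuple G, [&& path adj u p, last u p == v & uniq (u :: p)]].

Lemma joined_by_exists (u v : G) : connect adj u v -> exists n, joined_by u v n.
Proof.
case/connectP=> p up ->; case/shortenP: up => q uq Uq _.
by exists (size q); apply/existsP; exists (in_tuple q); rewrite uq Uq eqxx.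
Qed.

(* [None] stands for an infinite distance. *)
Definition gdist (u v : G) : option nat :=
  if @idP (connect adj u v) is ReflectT uv
  then Some (ex_minn (joined_by_exists uv)) else None.

Definition farther (s : nat) (u v : G) : bool :=
  if gdist u v is Some d then s < d else true.

End Distance.

(* Sequences and colors are indexed from 0: the term s_i of the sequence is
   [S (i - 1)], and the color i is [i - 1 : 'I_k]. *)
Definition packing_sequence (S : nat -> nat) : Prop :=
  (forall i, 0 < S i) /\ {homo S : i j / i <= j}.

Definition packing_coloring (S : nat -> nat) (G : sgraph) (k : nat)
    (c : {ffun G -> 'I_k}) : bool :=
  [forall u, forall v, (u != v) && (c u == c v) ==> farther (S (c u)) u v].

Definition packing_colorable (S : nat -> nat) (G : sgraph) (k : nat) : bool :=
  [exists c : {ffun G -> 'I_k}, packing_coloring S c].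

Lemma packing_colorable_exists (S : nat -> nat) (G : sgraph) :
  exists k, packing_colorable S G k.
Proof.
exists #|G|; apply/existsP; exists [ffun u => enum_rank u].
apply/forallP=> u; apply/forallP=> v; rewrite !ffunE.
by apply/implyP=> /andP[/eqP uv /eqP/enum_rank_inj].
Qed.

Definition packing_chromatic (S : nat -> nat) (G : sgraph) : nat :=
  ex_minn (packing_colorable_exists S G).

Section DeleteVertex.
Variables (G : sgraph) (u : G).

Definition del_adj : rel {x : G | x != u} := fun x y => adj (val x) (val y).

Lemma del_adj_sym : symmetric del_adj.
Proof. by move=> x y; apply: adj_sym. Qed.

Lemma del_adj_irr : irreflexive del_adj.
Proof. by move=> x; apply: adj_irr. Qed.

Definition del_vertex : sgraph := SGraph del_adj_sym del_adj_irr.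

End DeleteVertex.

Definition vertex_critical (S : nat -> nat) (G : sgraph) : Prop :=
  forall u : G, packing_chromatic S (del_vertex u) < packing_chromatic S G.

Definition vertex_critical4 (S : nat -> nat) (G : sgraph) : Prop :=
  packing_chromatic S G = 4 /\ vertex_critical S G.

Section EdgeList.
Variables (n : nat) (E : seq (nat * nat)).

Definition edges_adj : rel 'I_n := fun i j =>
  (i != j) && (((i : nat, j : nat) \in E) || ((j : nat, i : nat) \in E)).

Lemma edges_adj_sym : symmetric edges_adj.
Proof. by move=> i j; rewrite /edges_adj eq_sym orbC. Qed.

Lemma edges_adj_irr : irreflexive edges_adj.
Proof. by move=> i; rewrite /edges_adj eqxx. Qed.

Definition edges_graph : sgraph := SGraph edges_adj_sym edges_adj_irr.

End EdgeList.

Definition complete_graph (n : nat) : sgraph :=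
  edges_graph n [seq (i, j) | i <- iota 0 n, j <- iota 0 n].

Definition path_edges (n : nat) : seq (nat * nat) :=
  [seq (i, i.+1) | i <- iota 0 n.-1].

Definition cycle_edges (n : nat) : seq (nat * nat) :=
  [seq (i, i.+1 %% n) | i <- iota 0 n].

Definition cycle_graph (n : nat) : sgraph := edges_graph n (cycle_edges n).

(* The vertex v_i of the cycle is [i - 1]. *)
Definition chorded_cycle (n : nat) (chords : seq (nat * nat)) : sgraph :=
  edges_graph n (cycle_edges n ++ chords).

(* The path P_(2k-2) is 0, ..., 2k-3; the pendant vertices are 2k-2, 2k-1
   (at 0) and 2k, 2k+1 (at 2k-3). *)
Definition G2 (k : nat) : sgraph :=
  edges_graph (2 * k + 2)
    (path_edges (2 * k - 2) ++
     [:: (0, 2 * k - 2); (0, 2 * k - 1);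
         (2 * k - 3, 2 * k); (2 * k - 3, 2 * k + 1)]).

Definition in_C5_family (G : sgraph) : Prop :=
  [\/ graph_iso G (chorded_cycle 5 [:: (0, 2)]),
      graph_iso G (chorded_cycle 5 [:: (0, 2); (0, 3)]),
      graph_iso G (chorded_cycle 5 [:: (0, 2); (1, 3)])
    | graph_iso G (chorded_cycle 5 [:: (0, 3); (1, 4); (2, 4)])].

Definition in_C6_family (G : sgraph) : Prop :=
  exists chords : seq (nat * nat),
    [/\ chords != [::], subseq chords [:: (0, 3); (1, 4); (2, 5)]
      & graph_iso G (chorded_cycle 6 chords)].

Definition in_D_family (s4 : nat) (G : sgraph) : Prop :=
  exists n : nat,
    [/\ 5 <= n,
        [\/ n = 1 %[mod 4], n = 2 %[mod 4]
          | n = 3 %[mod 4] /\ s4 < n %/ 2]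
      & graph_iso G (cycle_graph n)].

Definition in_G2_family (G : sgraph) : Prop :=
  exists2 k : nat, 3 <= k & graph_iso G (G2 k).

(* The letters a, b, c, d, e, f, g are 0, 1, 2, 3, 4, 5, 6. *)
Definition H1 := edges_graph 5 [:: (0,1); (1,2); (2,3); (3,0); (1,3); (0,4)].
Definition H2 := edges_graph 5 [:: (0,1); (1,2); (2,0); (2,3); (3,4); (4,2)].
Definition H3 := edges_graph 6 [:: (0,1); (1,2); (2,0); (0,3); (1,4); (2,5)].
Definition H4 := edges_graph 5 [:: (0,1); (1,2); (2,0); (1,3); (3,4)].
Definition H5 := edges_graph 6 [:: (0,1); (1,2); (2,3); (3,0); (1,5); (2,4)].
Definition H7 :=
  edges_graph 6 [:: (0,1); (1,2); (2,3); (3,0); (2,4); (1,5); (3,5)].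
Definition H14 := edges_graph 7 [:: (0,1); (1,2); (2,3); (3,4); (2,5); (3,6)].
Definition H15 :=
  edges_graph 7 [:: (0,1); (1,2); (2,3); (3,0); (2,4); (4,5); (4,6)].

Definition in_H_family (G : sgraph) : Prop :=
  [\/ [\/ graph_iso G H1, graph_iso G H2, graph_iso G H3 | graph_iso G H4],
      graph_iso G H5, graph_iso G H7
    | graph_iso G H14 \/ graph_iso G H15].

(* Main.v *)
Require Import Defs.
From mathcomp Require Import all_boot.
From mathcomp Require Import zify.
From Stdlib Require Import Classical_Prop.

Set Implicit Arguments.
Unset Strict Implicit.
Unset Printing Implicit Defensive.

(** Call a graph tricolorable if it has a coloring with the gaps 1, 3, 3. (In
    the comments the colors are 1, 2, 3, 4; in the code they are 0, 1, 2, 3.)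
    A proper induced subgraph of a critical graph is tricolorable, so a critical
    graph that contains a non-tricolorable graph as an induced subgraph is
    isomorphic to it ([critical_iso]). Hence it suffices to find a listed graph
    inside every critical graph [G].

    If [G] has a triangle, then either two of its vertices meet all edges, and
    they can be given the colors 2 and 3, or a listed graph occurs on at most
    six vertices around the triangle ([triangle_listed]). If [G] has no triangle
    but has two adjacent vertices of degree at least 3, the same alternative
    holds for them, with at most seven vertices ([branch_edge_listed]). The
    graphs on these few vertices are searched by computation.

    Otherwise no two vertices of degree at least 3 are adjacent, so cycles have
    no chords. A cycle whose length is not divisible by 4 is not tricolorable,
    because along it the colors are forced to be 1, 2, 1, 3, 1, 2, and so on;
    hence [G] is that cycle ([cyc_critical_iso]). There remains the case in
    which all cycles have length divisible by 4. Then [G] is bipartite. If two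
    vertices of degree at least 3 lie at odd distance, a closest such pair spans
    an induced G_{2k} ([odd_branches_G2]). If there is no such pair, take a
    breadth-first search from a vertex of degree at least 3, give the color 1 to
    the odd levels and let the colors 2 and 3 alternate on the even levels: two
    vertices of the same even level with a common neighbor would produce a cycle
    of length 2 modulo 4 or a vertex of degree at least 3 on an odd level, so
    [G] would be tricolorable ([levels_tricolorable]).

    Conversely, the finite graphs of the list are checked by computation. A
    cycle forces the pattern above, and so does G_{2k}: a vertex of degree at
    least 3 cannot have the color 1, and the two ends of its path, at odd
    distance, cannot both avoid it ([fork_not_tricolorable]). In all of them but
    the cycles of length 3 modulo 4, a fourth color is needed only once, so its
    gap does not matter. In a cycle of length [n] with [n] equal to 3 modulo 4
    it is needed twice, and the best places for it are opposite each other; this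
    is possible exactly when the fourth gap is less than [n %/ 2]
    ([cycle_colorable4_bound], [cycle_colorable4_3]). *)

(** * Walks and distances *)

Section Walks.
Variable G : sgraph.
Implicit Types u v w : G.

Fixpoint walk (n : nat) u v : bool :=
  if n is m.+1 then [exists w, adj u w && walk m w v] else u == v.

Lemma adjC u v : adj u v = adj v u.
Proof. exact: adj_sym. Qed.

Lemma adj_neq u v : adj u v -> u != v.
Proof. by apply: contraTneq => ->; rewrite adj_irr. Qed.

Lemma walkS n u w v : adj u w -> walk n w v -> walk n.+1 u v.
Proof. by move=> uw wv; apply/existsP; exists w; rewrite uw. Qed.

Lemma walk1 u v : walk 1 u v = adj u v.
Proof.
by apply/existsP/idP=> [[w /andP[uw /eqP<-]] //|uv]; exists v; rewrite uv /=.
Qed.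

Lemma walk2P u v : reflect (exists2 w, adj u w & adj w v) (walk 2 u v).
Proof.
apply: (iffP existsP) => [[w /andP[uw]]|[w uw wv]].
  by rewrite -/(walk 1 w v) walk1; exists w.
by exists w; rewrite uw -/(walk 1 w v) walk1.
Qed.

Lemma walk_cat m n u v w : walk m u v -> walk n v w -> walk (m + n) u w.
Proof.
elim: m u => [|m IH] u; first by move/eqP->.
case/existsP=> z /andP[uz zv] vw; exact: walkS uz (IH _ zv vw).
Qed.

Lemma walkC n u v : walk n u v = walk n v u.
Proof.
suff sym a b : walk n a b -> walk n b a by apply/idP/idP; apply: sym.
elim: n a b => [|n IH] a b; first by move/eqP->; rewrite /= eqxx.
case/existsP=> z /andP[az zb]; rewrite -addn1.
by apply: walk_cat (IH _ _ zb) _; rewrite walk1 adjC.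
Qed.

Lemma walkP n u v :
  reflect (exists f : nat -> G, [/\ f 0 = u, f n = v &
                                   forall i, i < n -> adj (f i) (f i.+1)])
          (walk n u v).
Proof.
apply: (iffP idP) => [|[f [<- <-]]].
  elim: n u => [|n IH] u; first by move/eqP->; exists (fun=> v).
  case/existsP=> w /andP[uw /IH [f [f0 fn fS]]].
  by exists (fun i => if i is j.+1 then f j else u); split=> // [[_|i /fS]];
     rewrite ?f0.
elim: n f => [|n IH] f fS //=.
apply: (walkS (fS 0 isT)); apply: (IH (fun i => f i.+1)) => i lin; exact: fS.
Qed.

(** The distance of the definitions is a minimum over simple paths; shortening
    a walk to a simple path turns it into a statement on all walks. *)
Lemma fartherP s u v : farther s u v <-> forall n, walk n u v -> s < n.
Proof.
have path_walk w p : path adj w p -> walk (size p) w (last w p).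
  elim: p w => [|x p IH] w //= /andP[wx]; first by move/IH; apply: walkS wx.
have walk_path n a b : walk n a b ->
    exists p, [/\ path adj a p, last a p = b & size p = n].
  elim: n a => [|n IH] a; first by move/eqP->; exists [::].
  case/existsP=> w /andP[aw /IH [p [wp <- <-]]].
  by exists (w :: p); rewrite /= aw.
rewrite /farther /gdist; case: {-}_ / idP => [uv|nuv].
  case: ex_minnP => d /existsP[p /and3P[up /eqP lp _]] d_min.
  split=> [ltsd n /walk_path [q [uq lq <-]]|-> //].
    apply: leq_trans ltsd _; move: lq; case: (shortenP uq) => q' uq' Uq' sub lq.
    apply: leq_trans (d_min (size q') _) _.
      by apply/existsP; exists (in_tuple q'); rewrite uq' Uq' lq eqxx.
    by apply: uniq_leq_size sub; case/andP: Uq'.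
  by rewrite -(size_tuple p) -lp; apply: path_walk.
split=> // _ n /walk_path [p [up lp _]].
by case: nuv; apply/connectP; exists p.
Qed.

End Walks.

Lemma walk_homo (G H : sgraph) (f : G -> H) :
  {homo f : x y / adj x y} ->
  forall n, {homo f : x y / walk n x y}.
Proof.
move=> fh; elim=> [|n IH] x y; first by move/eqP->; rewrite /= eqxx.
by case/existsP=> w /andP[xw wy]; apply: walkS (fh _ _ xw) (IH _ _ wy).
Qed.

(** * Colorings and critical graphs *)

Section Colorings.
Variable S : nat -> nat.

Definition spaced (G : sgraph) (c : G -> nat) : Prop :=
  forall u v n, u != v -> c u = c v -> walk n u v -> S (c u) < n.

Definition colorable (G : sgraph) (k : nat) : Prop :=
  exists2 c : G -> nat, forall u, c u < k & spaced c.

Lemma packing_colorableP (G : sgraph) k :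
  packing_colorable S G k <-> colorable G k.
Proof.
split=> [/existsP[c /forallP cP]|[c ck cP]].
  exists (fun u => c u : nat) => // u v n uv cuv.
  have /forallP/(_ v)/implyP := cP u.
  have -> : c u == c v by apply/eqP/val_inj.
  by rewrite uv => /(_ isT)/fartherP; apply.
apply/existsP; exists [ffun u => Ordinal (ck u)].
apply/forallP=> u; apply/forallP=> v; apply/implyP=> /andP[uv].
rewrite !ffunE -val_eqE /= => /eqP cuv; apply/fartherP=> n; exact: cP.
Qed.

Lemma colorable_widen (G : sgraph) k l :
  k <= l -> colorable G k -> colorable G l.
Proof. by move=> kl [c ck cP]; exists c => // u; apply: leq_trans kl. Qed.

(** Distances can only grow in a subgraph, so colorings pull back along
    injective homomorphisms, induced or not. *)
Lemma colorable_sub (G H : sgraph) (f : G -> H) k :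
  injective f -> {homo f : x y / adj x y} -> colorable H k -> colorable G k.
Proof.
move=> fi fh [c ck cP]; exists (c \o f) => [u|u v n uv cuv /(walk_homo fh)].
  exact: ck.
by apply: cP => //; rewrite inj_eq.
Qed.

Lemma chromatic_leq (G : sgraph) k :
  packing_chromatic S G <= k <-> colorable G k.
Proof.
rewrite /packing_chromatic; case: ex_minnP => m /packing_colorableP mP m_min.
split=> [mk|/packing_colorableP/m_min //]; exact: colorable_widen mk mP.
Qed.

Lemma critical4P (G : sgraph) :
  vertex_critical4 S G <->
  [/\ ~ colorable G 3, colorable G 4 & forall u : G, colorable (del_vertex u) 3].
Proof.
split=> [[G4 Gc]|[n3 /chromatic_leq c4 dc]].
  split; rewrite -?chromatic_leq ?G4 // => u; apply/chromatic_leq.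
  by rewrite -ltnS -G4.
have G4: packing_chromatic S G = 4.
  by apply/eqP; rewrite eqn_leq c4 ltnNge; apply/negP=> /chromatic_leq.
by split=> // u; rewrite G4 ltnS; apply/chromatic_leq.
Qed.

End Colorings.

Lemma graph_iso_sub (G H : sgraph) : graph_iso G H ->
  exists2 f : H -> G, injective f & {mono f : x y / adj x y}.
Proof.
case=> f [g fK gK] fm; exists g; first exact: can_inj gK.
by move=> x y; rewrite -fm !gK.
Qed.

Lemma colorable_iso S (G H : sgraph) k :
  graph_iso G H -> colorable S G k -> colorable S H k.
Proof.
case/graph_iso_sub=> f fi fm; apply: (colorable_sub fi) => x y.
by rewrite fm.
Qed.

Lemma graph_iso_sym (G H : sgraph) : graph_iso G H -> graph_iso H G.
Proof.
case=> f [g fK gK] fm; exists g; first by exists f.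
by move=> x y; rewrite -fm !gK.
Qed.

Lemma colorable_del_sub S (G H : sgraph) (f : G -> H) (u : G) k : injective f ->
  {mono f : x y / adj x y} -> colorable S (del_vertex (f u)) k ->
  colorable S (del_vertex u) k.
Proof.
move=> fi fm; have fu (x : del_vertex u) : f (val x) != f u.
  by rewrite inj_eq // (valP x).
apply: (colorable_sub (f := fun x : del_vertex u =>
  exist (fun y => y != f u) (f (val x)) (fu x) : del_vertex (f u))).
  by move=> x y [/fi/val_inj].
by move=> x y; rewrite /= /del_adj /= fm.
Qed.

Lemma critical4_iso S (G H : sgraph) :
  graph_iso G H -> vertex_critical4 S H -> vertex_critical4 S G.
Proof.
move=> GH /critical4P[n3 c4 dc]; apply/critical4P; split.
- by move/(colorable_iso GH).
- exact: colorable_iso (graph_iso_sym GH) c4.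
case: GH => f fb fm u; exact: colorable_del_sub (bij_inj fb) fm (dc (f u)).
Qed.

(** The conditions for the gaps 1, 3, 3, without reference to a sequence. A color
    beyond the third is held to the third gap, which is harmless for a color
    that occurs only once. *)
Definition spaced133 (G : sgraph) (c : G -> nat) : Prop :=
  forall u v, u != v -> c u = c v ->
    ~~ adj u v /\ (c u != 0 -> forall n, walk n u v -> 3 < n).

Definition tricolorable (G : sgraph) : Prop :=
  exists2 c : G -> nat, forall u, c u < 3 & spaced133 c.

Lemma walk_farP (G : sgraph) (u v : G) :
  (forall n, walk n u v -> 3 < n) <->
  [/\ ~~ walk 0 u v, ~~ walk 1 u v, ~~ walk 2 u v & ~~ walk 3 u v].
Proof.
split=> [far|[w0 w1 w2 w3]]; first by split; apply/negP=> /far.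
by move=> [|[|[|[|n]]]] //; apply: contraTT => _.
Qed.

Lemma walk_gt1 (G : sgraph) (u v : G) n :
  u != v -> ~~ adj u v -> walk n u v -> 1 < n.
Proof.
by case: n => [|[|n]] // uv nadj; rewrite ?walk1 ?(negPf nadj) //= (negPf uv).
Qed.

Section Terms133.
Variable S : nat -> nat.
Hypotheses (S0 : S 0 = 1) (S1 : S 1 = 3) (S2 : S 2 = 3).

Lemma tricolorableP (G : sgraph) : colorable S G 3 <-> tricolorable G.
Proof.
split=> -[c c3 cP]; exists c => // u v.
  move=> uv cuv; split=> [|cu n /(cP u v n uv cuv)].
    apply/negP; rewrite -walk1 => /(cP _ _ _ uv cuv).
    by case: (c u) (c3 u) => [|[|[|]]]; rewrite // ?S0 ?S1 ?S2.
  by case: (c u) (c3 u) cu => [|[|[|]]] // _ _; rewrite ?S1 ?S2.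
move=> n uv cuv uvn; have [nadj far] := cP u v uv cuv.
case: (c u) (c3 u) far => [|[|[|]]] // _ far; rewrite ?S0 ?S1 ?S2 ?far //.
exact: walk_gt1 uv nadj uvn.
Qed.

(** A fourth color that occurs once makes no demand on the fourth term. *)
Lemma colorable4_once (G : sgraph) (w : G) (c : G -> nat) :
  (forall u, u != w -> c u < 3) -> c w = 3 -> spaced133 c -> colorable S G 4.
Proof.
move=> c3 cw cP; exists c => [u|u v n uv cuv uvn].
  by have [->|/c3/ltnW //] := eqVneq u w; rewrite cw.
have uw : u != w.
  apply: contraNneq uv => uw; rewrite uw in cuv *.
  by apply: contraT; rewrite eq_sym => /c3; rewrite -cuv cw.
have [nadj far] := cP u v uv cuv.
case: (c u) (c3 u uw) far => [|[|[|]]] // _ far; rewrite ?S0 ?S1 ?S2 ?far //.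
exact: walk_gt1 uv nadj uvn.
Qed.

Lemma critical4I (G : sgraph) : ~ tricolorable G -> colorable S G 4 ->
  (forall u : G, tricolorable (del_vertex u)) -> vertex_critical4 S G.
Proof.
move=> n3 c4 dc; apply/critical4P; split=> // [|u].
  by move/tricolorableP.
exact/tricolorableP.
Qed.

End Terms133.

(** Any sequence that begins with 1, 3, 3 serves to transfer [colorable_sub] to
    [tricolorable]. *)
Definition gap133 i := if i is 0 then 1 else 3.

Lemma tricolorable_sub (G H : sgraph) (f : G -> H) :
  injective f -> {homo f : x y / adj x y} -> tricolorable H -> tricolorable G.
Proof.
have P3 K := @tricolorableP gap133 erefl erefl erefl K.
by move=> fi fh /(P3 H) Hc; apply/(P3 G); apply: (colorable_sub fi fh Hc).
Qed.

Definition critical133 (G : sgraph) : Prop :=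
  ~ tricolorable G /\ forall u : G, tricolorable (del_vertex u).

Section Critical.
Variable G : sgraph.
Hypothesis Gcrit : critical133 G.

Lemma critical_sub_surj (F : sgraph) (f : F -> G) :
    ~ tricolorable F -> injective f -> {homo f : x y / adj x y} ->
  forall v, exists x, f x = v.
Proof.
move=> nF fi fh v; have [/existsP[x /eqP fx]|nv] := boolP [exists x, f x == v].
  by exists x.
have fv x : f x != v by move: nv; rewrite negb_exists => /forallP.
case: nF; apply: (tricolorable_sub (H := del_vertex v)
  (f := fun x => exist (fun y => y != v) (f x) (fv x))) (Gcrit.2 v).
  by move=> x y [] /fi.
by move=> x y /fh.
Qed.

(** A critical graph has no room for a vertex outside a subgraph that already
    fails to be colorable. *)
Lemma critical_iso (F : sgraph) (f : F -> G) :
  ~ tricolorable F -> injective f -> {mono f : x y / adj x y} -> graph_iso G F.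
Proof.
move=> nF fi fm; have fs : forall v, exists x, f x == v.
  move=> v; have [|x <-] := critical_sub_surj nF fi _ v; last by exists x.
  by move=> x y; rewrite fm.
pose g v := xchoose (fs v); have gK v : f (g v) = v by apply/eqP/(xchooseP (fs v)).
have fK x : g (f x) = x by apply: fi; rewrite gK.
exists g; first by exists f.
by move=> x y; rewrite -fm !gK.
Qed.

(** If [u] is out of reach of the start of a walk within its length, the walk
    avoids [u]. *)
Lemma walk_del (u x y : G) (xu : x != u) n :
    walk n x y -> ~~ [exists m : 'I_n.+1, walk m x u] ->
  forall yu : y != u,
  walk n (exist _ x xu : del_vertex u) (exist _ y yu : del_vertex u).
Proof.
elim: n x xu => [|n IH] x xu; first by move/eqP=> <- _ yu; rewrite /= -val_eqE.
case/existsP=> z /andP[xz zy] nx yu.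
have nz : ~~ [exists m : 'I_n.+1, walk m z u].
  apply: contra nx => /existsP[m zu]; apply/existsP.
  by exists (lift ord0 m); rewrite lift0; apply: walkS zu.
have zu : z != u.
  by apply: contra nz => zu; apply/existsP; exists ord0.
by apply: (@walkS (del_vertex u) n _ (exist _ z zu)); rewrite ?IH.
Qed.

(** If [v] were out of reach of [r], a coloring of the graph without [v] could
    be used on the component of [r] and one of the graph without [r] elsewhere. *)
Lemma critical_connected (r v : G) : exists n, walk n v r.
Proof.
case: (pickP (fun v => ~~ connect adj r v)) => [w nrw|con]; last first.
  have /connectP [p rp ->] := negbFE (con v).
  exists (size p); rewrite walkC; elim: p r rp {con} => [|x p IH] r /=.
    by rewrite eqxx.
  by case/andP=> rx xp; apply: walkS rx (IH _ xp).
have cw n x y : walk n x y -> connect adj x y.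
  elim: n x => [|n IH] x; first by move/eqP->; apply: connect0.
  by case/existsP=> z /andP[xz /IH]; apply: connect_trans; apply: connect1.
have csym : connect_sym (@adj G) by apply: sym_connect_sym; apply: adj_sym.
have [c1 c13 c1P] := Gcrit.2 w; have [c2 c23 c2P] := Gcrit.2 r.
pose in1 x : option (del_vertex w) := insub x.
pose in2 x : option (del_vertex r) := insub x.
pose c x := if connect adj r x then oapp c1 0 (in1 x) else oapp c2 0 (in2 x).
have neq_con x y : connect adj r x != connect adj r y -> x != y.
  by apply: contraNneq => ->.
case: Gcrit.1; exists c => [x|x y xy cxy].
  by rewrite /c; case: ifP => _; [case: (in1 x)|case: (in2 x)] => //= a.
have same n : walk n x y -> connect adj r x = connect adj r y.
  by move/cw => cxy'; rewrite !(csym r); apply: same_connect.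
case/boolP: (connect adj r x == connect adj r y) => [/eqP rxy|nrxy]; last first.
  split; first by apply: contra nrxy; rewrite -walk1 => /same ->.
  by move=> _ n /same E; rewrite E eqxx in nrxy.
move: cxy; rewrite /c -rxy; case: ifP => rx.
  have xw : x != w by apply: neq_con; rewrite rx (negPf nrw).
  have yw : y != w by apply: neq_con; rewrite -rxy rx (negPf nrw).
  rewrite /in1 !insubT /= => cxy.
  have [] := c1P (exist _ x xw) (exist _ y yw) _ cxy; first by rewrite -val_eqE.
  move=> nadj far; split=> // c0 n xyn; apply: far => //; apply: walk_del => //.
  apply: contra nrw => /existsP[m /cw]; exact: connect_trans.
have xr : x != r by apply: neq_con; rewrite rx connect0.
have yr : y != r by apply: neq_con; rewrite -rxy rx connect0.
rewrite /in2 !insubT /= => cxy.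
have [] := c2P (exist _ x xr) (exist _ y yr) _ cxy; first by rewrite -val_eqE.
move=> nadj far; split=> // c0 n xyn; apply: far => //; apply: walk_del => //.
by apply: contraFN rx => /existsP[m /cw]; rewrite csym.
Qed.

End Critical.

(** * Colorings from covers and labellings *)

(** Two vertices that meet every edge take the colors 2 and 3; all distance
    conditions are then void. *)
Lemma cover2_tricolorable (G : sgraph) (a b : G) :
  a != b -> (forall u v, adj u v -> [|| u == a, u == b, v == a | v == b]) ->
  tricolorable G.
Proof.
move=> ab cov; exists (fun x => if x == a then 1 else if x == b then 2 else 0).
  by move=> x; do !case: ifP.
move=> u v; have [-> /negPf|ua] := eqVneq u a.
  by rewrite eq_sym => ->; case: ifP.
have [-> bv|ub uv] := eqVneq u b.
  by have [//|va] := eqVneq v a; rewrite eq_sym (negPf bv).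
have [//|va] := eqVneq v a; have [//|vb _] := eqVneq v b; split=> //.
by apply/negP => /cov; rewrite (negPf ua) (negPf ub) (negPf va) (negPf vb).
Qed.

Definition tint d := if odd d then 0 else (odd d./2).+1.

Lemma tint_lt3 d : tint d < 3.
Proof. by rewrite /tint; do 2?case: (odd _). Qed.

(** If a labelling changes by exactly one along every edge, the parity of a
    walk is that of the difference of the labels of its ends, and the only
    walks of length at most 3 between distinct vertices of the same nonzero
    tint are walks of length 2 between vertices of the same label. *)
Lemma labelled_spaced (G : sgraph) (d : G -> nat) (P : pred G) :
    (forall u v, adj u v -> d u = (d v).+1 \/ d v = (d u).+1) ->
    (forall u v x, P u -> P v -> u != v -> d u = d v -> ~~ odd (d u) ->
       adj u x -> adj x v -> False) ->
  forall u v, P u -> P v -> u != v -> tint (d u) = tint (d v) ->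
    ~~ adj u v /\ (tint (d u) != 0 -> forall n, walk n u v -> 3 < n).
Proof.
move=> dS dP u v Pu Pv uv tuv.
have dW n a b : walk n a b -> odd (d a + d b) = odd n /\
    d a <= d b + n /\ d b <= d a + n.
  elim: n a => [|n IH] a; first by move/eqP->; lia.
  by case/existsP=> w /andP[/dS aw /IH]; lia.
have nadj : ~~ adj u v.
  apply/negP=> /dS; move: tuv; rewrite /tint.
  by case: (boolP (odd (d u))) => ou; case: (boolP (odd (d v))) => ov; lia.
split=> // tu; apply/walk_farP; rewrite walk1 nadj.
move: tuv tu; rewrite /tint.
case: (boolP (odd (d u))) => ou //; case: (boolP (odd (d v))) => ov // tuv _.
split=> //; last by apply/negP => /dW; lia.
apply/negP => uv2; have [E [E1 E2]] := dW _ _ _ uv2; case/walk2P: uv2 => x ux xv.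
apply: (dP _ _ _ Pu Pv uv _ ou ux xv); lia.
Qed.

Lemma labelled_tricolorable (G : sgraph) (d : G -> nat) :
    (forall u v, adj u v -> d u = (d v).+1 \/ d v = (d u).+1) ->
    (forall u v x, u != v -> d u = d v -> ~~ odd (d u) ->
       adj u x -> adj x v -> False) ->
  tricolorable G.
Proof.
move=> dS dP; exists (tint \o d) => [u|u v]; first exact: tint_lt3.
by apply: (@labelled_spaced _ d predT dS) => // a b x _ _; apply: dP.
Qed.

(** * Colors along trails and cycles *)

(** Among five consecutive terms that obey the gaps 1, 3, 3, the only patterns
    are 1, a, 1, b, 1 and a, 1, b, 1, a: two adjacent terms other than 1 would
    leave a pair of adjacent terms equal to 1. *)
Lemma window5 (g : nat -> nat) :
    (forall i, i < 5 -> g i < 3) ->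
    (forall i j, i < j -> j < 5 -> j <= i + 3 -> g i = g j ->
       g i = 0 /\ j <> i.+1) ->
  g 4 = g 0 /\ forall i, i < 4 -> (g i == 0) = (g i.+1 != 0).
Proof.
move=> g3 gP.
have pattern a b c d e : a < 3 -> b < 3 -> c < 3 -> d < 3 -> e < 3 ->
    [&& a != b, b != c, c != d & d != e] ->
    [&& (a == c) ==> (a == 0), (b == d) ==> (b == 0), (c == e) ==> (c == 0),
        (a == d) ==> (a == 0) & (b == e) ==> (b == 0)] ->
    [&& e == a, (a == 0) == (b != 0), (b == 0) == (c != 0),
        (c == 0) == (d != 0) & (d == 0) == (e != 0)].
  case: a => [|[|[|//]]]; case: b => [|[|[|//]]]; case: c => [|[|[|//]]] //;
    by case: d => [|[|[|//]]]; case: e => [|[|[|//]]].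
have far i j : i + 1 < j -> j < 5 -> j <= i + 3 -> (g i == g j) ==> (g i == 0).
  move=> ij j5 ji; apply/implyP=> /eqP E.
  by have [|-> //] := gP i j _ j5 ji E; lia.
have near i : i < 4 -> g i != g i.+1.
  by move=> i4; apply/eqP=> E; have [|||_ []] // := gP i i.+1 _ _ _ E; lia.
have /and5P[/eqP e04 /eqP e0 /eqP e1 /eqP e2 /eqP e3] :=
  pattern (g 0) (g 1) (g 2) (g 3) (g 4) (g3 0 isT) (g3 1 isT) (g3 2 isT)
    (g3 3 isT) (g3 4 isT) ltac:(by rewrite !near) ltac:(by rewrite !far).
by split=> // -[|[|[|[|]]]].
Qed.

(** Along a trail of at least five vertices, three colors can only follow the
    pattern 1, a, 1, b, 1, a, and so on: among four consecutive vertices the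
    colors 2 and 3 occur at most once each. *)
Lemma trail_colors (G : sgraph) (c : G -> nat) (f : nat -> G) a L :
    spaced133 c ->
    (forall i, a <= i -> i < a + L -> c (f i) < 3) ->
    (forall i, a <= i -> i.+1 < a + L -> adj (f i) (f i.+1)) ->
    (forall i j, a <= i -> i < j -> j <= i + 3 -> j < a + L -> f i != f j) ->
    4 < L ->
  (forall i, a <= i -> i + 4 < a + L -> c (f (i + 4)) = c (f i)) /\
  (forall i, a <= i -> i.+1 < a + L -> (c (f i) == 0) = (c (f i.+1) != 0)).
Proof.
move=> cP c3 fS fI L4.
have W i : a <= i -> i + 4 < a + L -> c (f (i + 4)) = c (f i) /\
    forall j, j < 4 -> (c (f (i + j)) == 0) = (c (f (i + j).+1) != 0).
  move=> ai iL; have := @window5 (fun j => c (f (i + j))).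
  rewrite addn0; case=> [j j5|j k jk k5 kj cjk|-> H]; first by apply: c3; lia.
    have fjk : f (i + j) != f (i + k) by apply: fI; lia.
    have [nadj far] := cP _ _ fjk cjk.
    split.
      apply/eqP; apply/negP=> /negP /far.
      suff /[swap] /[apply] : walk (k - j) (f (i + j)) (f (i + k)) by lia.
      apply/walkP; exists (fun t => f (i + j + t)).
      rewrite addn0; split=> // [|t tk]; first by congr f; lia.
      rewrite addnS; apply: fS; lia.
    move=> E; case/negP: nadj; rewrite E addnS; apply: fS; lia.
  by split=> // j j4; rewrite H // addnS.
split=> i ai iL; first by case: (W i ai iL).
have [iL4|iL4] := leqP (i + 5) (a + L).
  by have [_ /(_ 0 isT)] := W i ai ltac:(lia); rewrite addn0.
have [_ /(_ (i - (a + L - 5)))] := W (a + L - 5) ltac:(lia) ltac:(lia).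
by rewrite subnKC; [apply; lia|lia].
Qed.

Section Cycles.
Variable G : sgraph.

Definition cyc (n : nat) (f : nat -> G) : Prop :=
  (forall i, i < n -> adj (f i) (f (i.+1 %% n))) /\
  (forall i j, i < n -> j < n -> f i = f j -> i = j).

Lemma cycI n (f : nat -> G) :
    (forall i, i.+1 < n -> adj (f i) (f i.+1)) -> adj (f n.-1) (f 0) ->
    (forall i j, i < j -> j < n -> f i <> f j) -> 0 < n ->
  cyc n f.
Proof.
move=> fS fn fI n0; split=> [i lin|i j lin ljn E].
  have [lt|le] := ltnP i.+1 n; first by rewrite modn_small ?fS.
  have -> : i = n.-1 by lia.
  by rewrite prednK // modnn.
by case: (ltngtP i j) => // lt; [case: (fI _ _ lt ljn)|case: (fI _ _ lt lin)].
Qed.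

Definition wrap n (f : nat -> G) i := f (i %% n).

Lemma wrapS n f i : cyc n f -> 0 < n -> adj (wrap n f i) (wrap n f i.+1).
Proof.
move=> [fS _] n0; have := fS (i %% n) (ltn_pmod i n0).
by rewrite /wrap -addn1 modnDml addn1.
Qed.

Lemma wrap_inj n f i j : cyc n f -> 0 < n -> wrap n f i = wrap n f j ->
  i = j %[mod n].
Proof. by move=> [_ fI] n0; apply: fI; apply: ltn_pmod. Qed.

(** The period 4 of [trail_colors] meets the period [n] of a closed tour; if
    [n] is not a multiple of 4, vertices at distance [n %% 4] repeat a color. *)
Lemma cyc_not_tricolorable n f :
  cyc n f -> 4 < n -> ~~ (4 %| n) -> ~ tricolorable G.
Proof.
move=> fc n5 n4 [c c3 cP]; have n0 : 0 < n by lia.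
set g := wrap n f.
have gI i j : i < j -> j <= i + 3 -> g i != g j.
  move=> ij ji; apply/eqP => /(wrap_inj fc n0) E.
  have : n %| j - i by rewrite -eqn_mod_dvd ?E //; lia.
  by move=> /dvdn_leq; lia.
have [P4 P2] : (forall i, c (g (i + 4)) = c (g i)) /\
    forall i, (c (g i) == 0) = (c (g i.+1) != 0).
  have T i := @trail_colors G c g i 5 cP (fun j _ _ => c3 (g j))
    (fun j _ _ => wrapS j fc n0) (fun j k _ jk kj _ => gI j k jk kj) isT.
  by split=> i; have [H4 H1] := T i; [apply: H4|apply: H1]; lia.
have P4k k i : c (g (i + k * 4)) = c (g i).
  by elim: k => [|k IH]; rewrite ?addn0 // mulSn addnCA addnC P4.
have Pn i : c (g (i + n)) = c (g i) by rewrite /g /wrap modnDr.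
have Pr i : c (g i) = c (g (i + n %% 4)).
  have E : i + n = i + n %% 4 + n %/ 4 * 4 by have := divn_eq n 4; lia.
  by rewrite -(Pn i) E P4k.
have Z i : c (g i) = 0.
  have r3 : 0 < n %% 4 <= 3
    by have := ltn_pmod n (isT : 0 < 4); move: n4; rewrite /dvdn; lia.
  have := cP (g i) (g (i + n %% 4)) _ (Pr i); case; first by apply: gI; lia.
  move=> _ far; apply/eqP; apply/negP=> /negP /far /(_ (n %% 4)) H.
  suff /H : walk (n %% 4) (g i) (g (i + n %% 4)) by lia.
  apply/walkP; exists (fun t => g (i + t)); rewrite addn0; split=> // t _.
  by rewrite addnS; apply: wrapS.
by have := P2 0; rewrite !Z.
Qed.

End Cycles.

(** * Cycle graphs *)

Lemma cycle_adjE n (i j : cycle_graph n) :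
  adj i j = (i != j) && ((j == i.+1 %% n :> nat) || (i == j.+1 %% n :> nat)).
Proof.
have E (a b : 'I_n) : ((a : nat, b : nat) \in cycle_edges n) = (b == a.+1 %% n :> nat).
  apply/mapP/eqP=> [[k _ [-> ->]] //|bE]; exists (a : nat); last by rewrite -bE.
  by rewrite mem_iota /=.
by rewrite /= /edges_adj !E.
Qed.

Section CycleGraph.
Variable n : nat.
Hypothesis n4 : 4 < n.

Definition cycle_index (u : cycle_graph n) : nat := nat_of_ord (u : 'I_n).

Lemma cycle_index_lt u : cycle_index u < n.
Proof. exact: ltn_ord. Qed.

Lemma cycle_index_inj : injective cycle_index.
Proof. exact: val_inj. Qed.

Lemma cycle_adj_cases u v : adj u v -> let i := cycle_index u in
  let j := cycle_index v in
  [\/ j = i.+1, i = j.+1, i = n.-1 /\ j = 0 | j = n.-1 /\ i = 0].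
Proof.
have := cycle_index_lt u; have := cycle_index_lt v.
rewrite cycle_adjE -/(cycle_index u) -/(cycle_index v).
move: (cycle_index u) (cycle_index v) => i j jn lin /andP[_] /=.
have mS k : k < n -> k.+1 %% n = if k.+1 < n then k.+1 else 0.
  move=> kn; case: ltnP => kn'; first by rewrite modn_small.
  have -> : k.+1 = n by lia.
  by rewrite modnn.
rewrite !mS //; case/orP=> /eqP; case: ifP => ? ?.
- exact: Or41.
- by apply: Or43; lia.
- exact: Or42.
by apply: Or44; lia.
Qed.

(** Each step changes the index by one, up to a full turn. *)
Lemma cycle_walk l u v : walk l u v ->
  let i := cycle_index u in let j := cycle_index v in
  (j <= i + l \/ i + n <= j + l) /\ (i <= j + l \/ j + n <= i + l).
Proof.
elim: l u => [|l IH] u; first by move/eqP->; lia.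
case/existsP=> w /andP[/cycle_adj_cases + /IH]; have := cycle_index_lt w.
have := cycle_index_lt u; have := cycle_index_lt v.
move: (cycle_index u) (cycle_index v) (cycle_index w) => i j k jn lin kn /=.
by case=> [||[]|[]] -> => [|||->]; lia.
Qed.

Let n0 : 0 < n. Proof. exact: leq_ltn_trans n4. Qed.
Definition cycle_vertex i : cycle_graph n := Ordinal (ltn_pmod i n0).

Lemma cycle_vertexE i : cycle_index (cycle_vertex i) = i %% n.
Proof. by []. Qed.

Lemma cycle_vertexK u : cycle_vertex (cycle_index u) = u.
Proof.
by apply: cycle_index_inj; rewrite cycle_vertexE modn_small ?cycle_index_lt.
Qed.

Lemma cycle_vertex_mod i j : i = j %[mod n] -> cycle_vertex i = cycle_vertex j.
Proof. by move=> E; apply: cycle_index_inj; rewrite !cycle_vertexE. Qed.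

Lemma cycle_vertexS i : adj (cycle_vertex i) (cycle_vertex i.+1).
Proof.
rewrite cycle_adjE -/(cycle_index _) -/(cycle_index (cycle_vertex i.+1)).
rewrite -(inj_eq cycle_index_inj) !cycle_vertexE -[i.+1]addn1 -[(i %% n).+1]addn1.
rewrite modnDml eqxx andbT; apply/negP; rewrite -{1}[i]addn0 eqn_modDl mod0n.
by rewrite modn_small //; lia.
Qed.

Lemma cycle_vertex_walk i l : walk l (cycle_vertex i) (cycle_vertex (i + l)).
Proof.
apply/walkP; exists (fun t => cycle_vertex (i + t)); rewrite addn0.
by split=> // t _; rewrite addnS; apply: cycle_vertexS.
Qed.

Lemma cycle_cyc_vertex : cyc n cycle_vertex.
Proof.
split=> [i lin|i j lin ljn /(congr1 cycle_index)]; last first.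
  by rewrite !cycle_vertexE !modn_small.
by rewrite (@cycle_vertex_mod (i.+1 %% n) i.+1) ?modn_mod ?cycle_vertexS.
Qed.

Lemma cycle_vertex_neq i j : i < j -> j <= i + 3 ->
  cycle_vertex i != cycle_vertex j.
Proof.
move=> ij ji; rewrite -(inj_eq cycle_index_inj) !cycle_vertexE.
have -> : j = i + (j - i) by lia.
rewrite -{1}[i]addn0 eqn_modDl mod0n modn_small; lia.
Qed.

(** Without one vertex the cycle is a path, labelled by the position after it. *)
Lemma cycle_del_tricolorable (u : cycle_graph n) : tricolorable (del_vertex u).
Proof.
pose lab i := if i < cycle_index u then i + n - cycle_index u
  else i - cycle_index u.
pose d (x : del_vertex u) := lab (cycle_index (val x)).
have ne (x : del_vertex u) : cycle_index (val x) != cycle_index u.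
  by rewrite (inj_eq cycle_index_inj) (valP x).
apply: (@labelled_tricolorable _ d) => [x y|x y z xy E _ _ _].
  move/cycle_adj_cases; have := ne x; have := ne y.
  have := cycle_index_lt (val x); have := cycle_index_lt (val y).
  have := cycle_index_lt u; rewrite /d /lab /=.
  move: (cycle_index u) (cycle_index (val x)) (cycle_index (val y)) => a i j.
  by move=> an jn lin ja ia; case=> [||[]|[]]; do 2?[case: ifP]; lia.
case/eqP: xy; apply: val_inj; apply: cycle_index_inj; move: E.
have := ne x; have := ne y.
have := cycle_index_lt (val x); have := cycle_index_lt (val y).
have := cycle_index_lt u; rewrite /d /lab {lab d ne}.
move: (cycle_index u) (cycle_index (val x)) (cycle_index (val y)) => a i j.
by do 2?[case: ifP]; lia.
Qed.

Section Terms.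
Variable S : nat -> nat.
Hypotheses (S0 : S 0 = 1) (S1 : S 1 = 3) (S2 : S 2 = 3).

(** The pattern 1, 3, 1, 2 is repeated and the last vertex takes the fourth
    color. *)
Lemma cycle_colorable4_12 : (n %% 4 == 1) || (n %% 4 == 2) ->
  colorable S (cycle_graph n) 4.
Proof.
move=> n12; pose h i := if i == n.-1 then 3 else tint i.+1.
have cS i j l : i < j -> j < n -> h i = h j ->
    (j <= i + l \/ i + n <= j + l) -> if h i == 0 then 1 < l else 3 < l.
  rewrite /h /tint /=; case: (i =P n.-1) => i4; case: (j =P n.-1) => j4;
    case: (boolP (odd i)) => oi; case: (boolP (odd j)) => oj /=; lia.
have sp u v l : u != v -> h (cycle_index u) = h (cycle_index v) -> walk l u v ->
    if h (cycle_index u) == 0 then 1 < l else 3 < l.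
  rewrite -(inj_eq cycle_index_inj) => uv E /cycle_walk /= [w1 w2].
  case: (ltngtP (cycle_index u) (cycle_index v)) uv => // uv _.
    exact: cS uv (cycle_index_lt v) E w1.
  by rewrite E; apply: cS uv (cycle_index_lt u) (esym E) w2.
have wE : cycle_index (cycle_vertex n.-1) = n.-1.
  by rewrite cycle_vertexE modn_small //; lia.
apply: (colorable4_once S0 S1 S2 (w := cycle_vertex n.-1)
  (c := fun u => h (cycle_index u))) => [u||u v uv E].
- rewrite -(inj_eq cycle_index_inj) wE /h => /negPf->; exact: tint_lt3.
- by rewrite wE /h eqxx.
split; first by apply/negP; rewrite -walk1 => /(sp _ _ _ uv E); case: ifP.
by move=> /negPf c0 l /(sp _ _ _ uv E); rewrite c0.
Qed.

(** The two vertices of the fourth color cut the cycle into arcs whose lengths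
    are the two integers next to [n / 2]. The odd positions alternate between
    the colors 2 and 3, in the opposite order behind the middle, and the even
    positions take the color 1. *)
Lemma cycle_colorable4_3 : n %% 4 = 3 -> S 3 < n %/ 2 ->
  colorable S (cycle_graph n) 4.
Proof.
move=> n3 s4; pose half := n %/ 2; have nE : n = half.*2.+1 by rewrite /half; lia.
have oh : odd half by rewrite /half; lia.
pose h i := if (i == n.-1) || (i == half) then 3
  else if odd i then (odd i./2 (+) (half < i)).+1 else 0.
have cS i j l : i < j -> j < n -> h i = h j ->
    (j <= i + l \/ i + n <= j + l) -> S (h i) < l.
  rewrite /h => ij jn; case: (boolP (_ || _)) => i4; case: (boolP (_ || _)) => j4.
  - by move=> _ w; apply: (leq_trans s4); rewrite -/half; move: i4 j4; lia.
  - by case: (odd j) => //; case: (_ (+) _).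
  - by case: (odd i) => //; case: (_ (+) _).
  have S12 (b : bool) : S b.+1 = 3 by case: b.
  case: (boolP (odd i)) => oi; case: (boolP (odd j)) => oj //;
    rewrite ?S12 ?S0; last by lia.
  move=> E; have {E} : odd i./2 (+) (half < i) = odd j./2 (+) (half < j).
    by move: E; case: (_ (+) _); case: (_ (+) _).
  by move: i4 j4; case: (ltnP half i) => hi; case: (ltnP half j) => hj; lia.
exists (h \o cycle_index) => [u|u v l].
  by rewrite /= /h; case: ifP => // _; case: ifP => // _; case: (_ (+) _).
rewrite -(inj_eq cycle_index_inj) /= => uv E /cycle_walk /= [w1 w2].
case: (ltngtP (cycle_index u) (cycle_index v)) uv => // uv _.
  exact: cS uv (cycle_index_lt v) E w1.
by rewrite E; apply: cS uv (cycle_index_lt u) (esym E) w2.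
Qed.

End Terms.

End CycleGraph.

Section Terms.
Variable S : nat -> nat.
Hypotheses (S0 : S 0 = 1) (S1 : S 1 = 3) (S2 : S 2 = 3).

(** All vertices are within distance [n / 2]. If the fourth color could only
    be used once, three colors would be left for [n - 1 = 4 q + 2] consecutive
    vertices; the first two of them then repeat the colors of the last two, at
    distance 3 around the remaining vertex, so both get the color 1 although
    they are adjacent. *)
Lemma cycle_colorable4_bound n : 4 < n -> n %% 4 = 3 ->
  colorable S (cycle_graph n) 4 -> S 3 < n %/ 2.
Proof.
move=> n4 n3 [c c4 cP]; rewrite ltnNge; apply/negP=> s4.
pose g := cycle_vertex n4.
have once u v : c u = 3 -> c v = 3 -> u = v.
  move=> cu cv; apply/eqP; apply: contraT => uv.
  have far l : walk l u v -> n %/ 2 < l.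
    by move=> /(cP _ _ _ uv); rewrite cu cv => /(_ erefl); apply: leq_ltn_trans.
  have arc i j : i < j -> j < n -> (g i = u /\ g j = v) \/ (g i = v /\ g j = u) -> False.
    move=> ij jn gij.
    have w1 : walk (j - i) (g i) (g j).
      by have := cycle_vertex_walk n4 i (j - i); rewrite subnKC // ltnW.
    have w2 : walk (n - (j - i)) (g j) (g i).
      have := cycle_vertex_walk n4 j (n - (j - i)).
      have -> : j + (n - (j - i)) = i + n by clear -ij jn; lia.
      by rewrite (@cycle_vertex_mod _ n4 (i + n) i) // modnDr.
    suff [f1 f2] : n %/ 2 < j - i /\ n %/ 2 < n - (j - i) by clear -f1 f2 ij jn; lia.
    case: gij => [[gi gj]|[gi gj]]; rewrite gi gj in w1 w2.
      by split; apply: far; rewrite // walkC.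
    by split; apply: far; rewrite // walkC.
  case: (ltngtP (cycle_index u) (cycle_index v)) => lt.
  - by case: (arc _ _ lt (cycle_index_lt v)); left; rewrite /g !cycle_vertexK.
  - by case: (arc _ _ lt (cycle_index_lt u)); right; rewrite /g !cycle_vertexK.
  by rewrite (cycle_index_inj lt) eqxx in uv.
have lt3 u : c u != 3 -> c u < 3 by have := c4 u; lia.
have sp : spaced133 c.
  move=> u v uv cuv; have u3 : c u < 3.
    by apply: lt3; apply: contraNneq uv => cu; apply/eqP/once; rewrite -?cuv.
  split=> [|cu l uvl]; first by apply/negP; rewrite -walk1 => /(cP _ _ _ uv cuv);
    case: (c u) u3 => [|[|[|]]] //; rewrite ?S0 ?S1 ?S2.
  by have := cP _ _ _ uv cuv uvl; case: (c u) u3 cu => [|[|[|]]] //; rewrite ?S1 ?S2.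
have [w cw] : exists w, c w = 3.
  case: (pickP (fun w => c w == 3)) => [w /eqP|no]; first by exists w.
  case: (cyc_not_tricolorable (cycle_cyc_vertex n4) n4).
    by rewrite /dvdn n3.
  by exists c => // u; apply: lt3; rewrite no.
pose a := cycle_index w; have ga : g a = w by apply: cycle_vertexK.
clearbody a.
have gS i : adj (g i) (g i.+1) by apply: cycle_vertexS.
have gN i j : i < j -> j <= i + 3 -> g i != g j by apply: cycle_vertex_neq.
have g3 i : a.+1 <= i -> i < a.+1 + n.-1 -> c (g i) < 3.
  move=> ai ian; apply: lt3; apply/eqP=> ci.
  have := once _ _ ci cw; rewrite -ga => /(congr1 (@cycle_index n)).
  rewrite !cycle_vertexE => /eqP; have -> : i = a + (i - a) by lia.
  rewrite -[X in _ == X %[mod _]]addn0 eqn_modDl mod0n.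
  by rewrite modn_small; clear -ai ian n4; lia.
have L4 : 4 < n.-1 by clear -n4 n3; lia.
have [P4 P1] := @trail_colors _ c g a.+1 n.-1 sp g3 (fun i _ _ => gS i)
  (fun i j _ ij ji _ => gN i j ij ji) L4.
have rep k b : a < b -> b + k * 4 < a + n -> c (g (b + k * 4)) = c (g b).
  elim: k => [|k IH] ab bk; first by rewrite addn0.
  rewrite mulSn [4 + _]addnC addnA P4; [apply: IH|..]; lia.
have zero b : a < b -> b < a + 3 -> c (g b) = 0.
  move=> ab ba; pose k := (n - 3) %/ 4; have kE : k * 4 = n - 3 by rewrite /k; lia.
  have E : c (g (b + k * 4)) = c (g b) by apply: rep; lia.
  have W : walk 3 (g (b + k * 4)) (g b).
    have := cycle_vertex_walk n4 (b + k * 4) 3.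
    have -> : b + k * 4 + 3 = b + n by lia.
    by rewrite (@cycle_vertex_mod _ n4 (b + n) b) // modnDr.
  have N : g (b + k * 4) != g b.
    have := gN (b + k * 4) (b + n); rewrite /g.
    by rewrite (@cycle_vertex_mod _ n4 (b + n) b) ?modnDr //; apply; lia.
  have [_ far] := sp _ _ N E; apply/eqP; apply: contraT; rewrite -E.
  by move=> /far/(_ 3 W).
by have := P1 a.+1 (leqnn _); rewrite !zero //; try lia; move=> /(_ ltac:(lia)).
Qed.

End Terms.

(** * Cycles without chords *)

Definition branch (G : sgraph) (v : G) : bool :=
  [exists a, exists b, exists c,
    [&& a != b, a != c, b != c, adj v a, adj v b & adj v c]].

Lemma branchI (G : sgraph) (v a b c : G) :
  adj v a -> adj v b -> adj v c -> a != b -> a != c -> b != c -> branch v.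
Proof.
move=> va vb vc ab ac bc; apply/existsP; exists a; apply/existsP; exists b.
by apply/existsP; exists c; rewrite va vb vc ab ac bc.
Qed.

Lemma branch_other (G : sgraph) (v y : G) : branch v ->
  exists a b, [/\ adj v a, adj v b, a != b, a != y & b != y].
Proof.
case/existsP=> a /existsP[b /existsP[c /and5P[ab ac bc va /andP[vb vc]]]].
have [ay|ay] := eqVneq a y; first by exists b, c; rewrite -ay ![_ == a]eq_sym.
have [bY|bY] := eqVneq b y; last by exists a, b.
by exists a, c; rewrite -bY [c == b]eq_sym.
Qed.

Section Chordless.
Variable G : sgraph.
Hypothesis branch_nadj : forall u v : G, branch u -> branch v -> ~~ adj u v.

(** The ends of a chord would be adjacent vertices of degree at least 3. *)
Lemma cyc_chordless n f i j : cyc (G := G) n f -> 3 < n -> i < n -> j < n ->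
  adj (f i) (f j) = (j == i.+1 %% n) || (i == j.+1 %% n).
Proof.
move=> [fS fI] n3 lin ljn; apply/idP/idP=> [fij|/orP[/eqP->|/eqP->]]; last 2 first.
- exact: fS.
- by rewrite adjC; apply: fS.
apply: contraT; rewrite negb_or => /andP[nij nji].
have n0 : 0 < n by lia.
have neq a b : a < n -> b < n -> a != b -> f a != f b.
  by move=> an bn; apply: contra => /eqP/fI ->.
have chord a b : a < n -> b < n -> adj (f a) (f b) ->
    b != a.+1 %% n -> a != b.+1 %% n -> branch (f a).
  move=> an bn fab nab nba.
  pose p := (a + n.-1) %% n; have pn : p < n by rewrite ltn_pmod.
  have pS : p.+1 %% n = a.
    by rewrite -addn1 modnDml -addnA addn1 prednK // modnDr modn_small.
  have sn : a.+1 %% n < n by rewrite ltn_pmod.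
  have fp : adj (f a) (f p) by rewrite adjC; have := fS p pn; rewrite pS.
  apply: (branchI (fS a an) fp fab); apply: neq => //.
  - apply/eqP=> E; move: pS; rewrite -E -addn1 modnDml => aS.
    have : a + 0 == a + 2 %[mod n].
      by apply/eqP; rewrite addn0 (modn_small an) -[in LHS]aS; congr (_ %% _); lia.
    by rewrite eqn_modDl mod0n modn_small; lia.
  - by rewrite eq_sym.
  - by apply: contra nba => /eqP <-; rewrite pS.
have bi := chord i j lin ljn fij nij nji.
have bj : branch (f j) by apply: (chord j i) => //; rewrite adjC.
by have := branch_nadj bi bj; rewrite fij.
Qed.

(** The cycle is an induced subgraph that is not tricolorable. *)
Lemma cyc_critical_iso n f : critical133 G -> cyc (G := G) n f -> 4 < n ->
  ~~ (4 %| n) -> graph_iso G (cycle_graph n).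
Proof.
move=> Gc fc n4 nd4.
apply: (critical_iso Gc (f := (fun i : 'I_n => f i) : cycle_graph n -> G)).
- exact: cyc_not_tricolorable (cycle_cyc_vertex n4) n4 nd4.
- by move=> i j /(fc.2 _ _ (ltn_ord i) (ltn_ord j))/val_inj.
move=> i j; rewrite cycle_adjE (cyc_chordless fc) //; last lia.
have [<-|//] := eqVneq i j; rewrite orbb.
have lin := ltn_ord i; apply/negbTE/eqP; have [lt|le] := ltnP i.+1 n.
  by rewrite modn_small //; lia.
have -> : i.+1 = n by lia.
by rewrite modnn; lia.
Qed.

End Chordless.

(** * Finitely many small graphs, by computation *)

Definition edge_rel (E : seq (nat * nat)) : rel nat := fun i j =>
  (i != j) && (((i, j) \in E) || ((j, i) \in E)).

Definition near (e : rel nat) (W : seq nat) (u v : nat) : bool :=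
  [|| e u v, has (fun w => e u w && e w v) W
    | has (fun w => has (fun z => [&& e u w, e w z & e z v]) W) W].

Definition conflicts (r : rel nat) (W : seq nat) : seq (nat * nat) :=
  [seq p <- [seq (u, v) | u <- W, v <- W] | (p.1 != p.2) && r p.1 p.2].

(** [A] and [N] stand for the pairs of adjacent vertices and of vertices at
    distance at most 3; they are parameters in order to be computed once for all
    colorings of a graph. *)
Definition respects (A N : seq (nat * nat)) (l : seq nat) : bool :=
  all (fun p => nth 0 l p.1 != nth 0 l p.2) A &&
  all (fun p => (nth 0 l p.1 != nth 0 l p.2) || (nth 0 l p.1 == 0)) N.

Lemma conflictsP r (W : seq nat) u v :
  ((u, v) \in conflicts r W) = [&& u \in W, v \in W, u != v & r u v].
Proof.
rewrite mem_filter /= -andbA; set m := (u, v) \in _.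
have -> : m = (u \in W) && (v \in W).
  by apply/allpairsP/andP=> [[[a b] [aW bW [-> ->]]]|[uW vW]] //; exists (u, v).
by case: (u \in W); case: (v \in W); rewrite ?andbT ?andbF.
Qed.

(** The vertices of [H] are presented as the numbers in [W]; this covers both a
    graph on all numbers below a bound and the same graph without a vertex. *)
Section Present.
Variables (e : rel nat) (W : seq nat) (H : sgraph) (lab : H -> nat).
Hypothesis lab_inj : injective lab.
Hypothesis lab_mem : forall x, lab x \in W.
Hypothesis lab_onto : forall w, w \in W -> exists x, lab x = w.
Hypothesis lab_adj : forall x y, adj x y = e (lab x) (lab y).

Lemma near_walk x y :
  near e W (lab x) (lab y) = [|| walk 1 x y, walk 2 x y | walk 3 x y].
Proof.
rewrite /near walk1 lab_adj; congr [|| _, _ | _].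
  apply/hasP/walk2P=> [[w /lab_onto[z <-]]|[z]].
    by rewrite -!lab_adj => /andP[xz zy]; exists z.
  by rewrite !lab_adj => xz zy; exists (lab z); rewrite ?lab_mem ?xz.
apply/hasP/existsP=> [[w /lab_onto[z <-] /hasP[w' /lab_onto[z' <-]]]|[z]].
  rewrite -!lab_adj => /and3P[xz zz zy]; exists z; rewrite xz.
  by apply/walk2P; exists z'.
case/andP=> xz /walk2P[z' zz zy]; exists (lab z) => //.
by apply/hasP; exists (lab z') => //; rewrite -!lab_adj xz zz.
Qed.

Lemma respectsP l :
  respects (conflicts e W) (conflicts (near e W) W) l <->
  spaced133 (fun x : H => nth 0 l (lab x)).
Proof.
split=> [/andP[/allP aA /allP aN] x y xy cxy|sp].
  split.
    apply/negP; rewrite lab_adj => xye.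
    have /aA : (lab x, lab y) \in conflicts e W.
      by rewrite conflictsP !lab_mem xye (inj_eq lab_inj) xy.
    by rewrite /= cxy eqxx.
  move=> c0; apply/walk_farP; rewrite /= xy /=.
  have : (lab x, lab y) \notin conflicts (near e W) W.
    by apply/negP => /aN /=; rewrite cxy eqxx -cxy (negPf c0).
  rewrite conflictsP !lab_mem (inj_eq lab_inj) xy near_walk /=.
  by rewrite !negb_or => /and3P[].
apply/andP; split; apply/allP=> -[a b]; rewrite conflictsP => /and4P[];
  move=> /lab_onto[x <-] /lab_onto[y <-]; rewrite (inj_eq lab_inj) /= => xy.
  rewrite -lab_adj => ad; apply/negP=> /eqP /(sp _ _ xy) [].
  by rewrite ad.
rewrite near_walk => nr; case: eqP => [/(sp _ _ xy)[_ far]|//].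
apply: contraT=> /far/walk_farP[_ w1 w2 w3].
by move: nr; rewrite (negPf w1) (negPf w2) (negPf w3).
Qed.

End Present.

Fixpoint colorings n : seq (seq nat) :=
  if n is m.+1 then [seq a :: l | a <- [:: 0; 1; 2], l <- colorings m]
  else [:: [::]].

Lemma mem_colorings n l :
  (l \in colorings n) = (size l == n) && all (fun a => a < 3) l.
Proof.
elim: n l => [|n IH] l; first by rewrite inE; case: l.
have -> : colorings n.+1 = [seq a :: l | a <- [:: 0; 1; 2], l <- colorings n] by [].
apply/allpairsP/idP=> [[[b m] /= [bi mi ->]]|].
  by move: mi bi; rewrite IH !inE /= eqSS => /andP[-> ->]; lia.
case: l => // a l /= /andP[sl /andP[a3 al]]; exists (a, l).
by rewrite /= IH -eqSS sl al !inE; split=> //; lia.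
Qed.

Definition fin_not_tricolorable n E : bool :=
  let e := edge_rel E in let W := iota 0 n in
  let A := conflicts e W in let N := conflicts (near e W) W in
  all (fun l => ~~ respects A N l) (colorings n).

Definition fin_colorable4 n E : bool :=
  let e := edge_rel E in let W := iota 0 n in
  let A := conflicts e W in let N := conflicts (near e W) W in
  has (fun w => has (fun l => respects A N (set_nth 0 l w 3)) (colorings n)) W.

Definition fin_del_tricolorable n E : bool :=
  let e := edge_rel E in
  all (fun u => let W := rem u (iota 0 n) in
    let A := conflicts e W in let N := conflicts (near e W) W in
    has (respects A N) (colorings n)) (iota 0 n).

Section FiniteSound.
Variables (n : nat) (E : seq (nat * nat)).
Let H := edges_graph n E.
Let labH (i : H) := nat_of_ord (i : 'I_n).

Let labH_inj : injective labH. Proof. exact: val_inj. Qed.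
Let labH_mem x : labH x \in iota 0 n.
Proof. by rewrite mem_iota add0n /labH ltn_ord. Qed.
Let labH_onto w : w \in iota 0 n -> exists x, labH x = w.
Proof. by rewrite mem_iota add0n /= => wn; exists (Ordinal wn). Qed.
Let labH_adj x y : adj x y = edge_rel E (labH x) (labH y).
Proof. by []. Qed.

Lemma fin_not_tricolorableP : fin_not_tricolorable n E -> ~ tricolorable H.
Proof.
move=> /allP nE [c c3 cP]; pose l := [seq c i | i <- enum 'I_n].
have lE x : nth 0 l (labH x) = c x.
  by rewrite (nth_map x) ?size_enum_ord ?ltn_ord ?nth_ord_enum.
have /nE/negP : l \in colorings n.
  rewrite mem_colorings size_map size_enum_ord eqxx.
  by apply/allP=> _ /mapP[x _ ->]; apply: c3.
apply; apply/(respectsP labH_inj labH_mem labH_onto labH_adj) => x y xy.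
by rewrite !lE; apply: cP.
Qed.

Lemma fin_colorable4P : fin_colorable4 n E ->
  exists (w : H) (c : H -> nat),
    [/\ forall u, u != w -> c u < 3, c w = 3 & spaced133 c].
Proof.
move=> /hasP[a /labH_onto[w <-] /hasP[l]].
rewrite mem_colorings => /andP[/eqP ln l3].
move/(respectsP labH_inj labH_mem labH_onto labH_adj) => sp.
exists w; exists (fun x => nth 0 (set_nth 0 l (labH w) 3) (labH x)); split=> //.
  move=> u uw; rewrite nth_set_nth /= (inj_eq labH_inj) (negPf uw).
  by apply: (allP l3); rewrite mem_nth // ln ltn_ord.
by rewrite nth_set_nth /= eqxx.
Qed.

Lemma fin_del_tricolorableP : fin_del_tricolorable n E ->
  forall u : H, tricolorable (del_vertex u).
Proof.
move=> /allP dE u; have /dE/hasP[l] := labH_mem u.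
rewrite mem_colorings => /andP[/eqP ln l3].
have um : uniq (iota 0 n) by apply: iota_uniq.
move/(@respectsP _ _ (del_vertex u) (fun x => labH (val x))) => H4.
exists (fun x => nth 0 l (labH (val x))) => [x|].
  by apply: (allP l3); rewrite mem_nth // ln ltn_ord.
apply: H4 => //.
- by move=> x y /labH_inj/val_inj.
- move=> x; rewrite mem_rem_uniq // inE labH_mem andbT (inj_eq labH_inj).
  exact: valP x.
move=> w; rewrite mem_rem_uniq // inE => /andP[wu /labH_onto[x wE]].
have xu : x != u by rewrite -(inj_eq labH_inj) wE.
by exists (exist _ x xu).
Qed.

End FiniteSound.

(** All finite graphs of the list, with the seven chord sets of the 6-cycle kept
    apart. The 5-cycle is added because it can be the only critical subgraph on
    the few vertices that are searched. *)
Definition catalogue : seq (nat * seq (nat * nat)) :=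
  [:: (4, [seq (i, j) | i <- iota 0 4, j <- iota 0 4]);
      (5, [:: (0,1); (1,2); (2,3); (3,0); (1,3); (0,4)]);
      (5, [:: (0,1); (1,2); (2,0); (2,3); (3,4); (4,2)]);
      (6, [:: (0,1); (1,2); (2,0); (0,3); (1,4); (2,5)]);
      (5, [:: (0,1); (1,2); (2,0); (1,3); (3,4)]);
      (6, [:: (0,1); (1,2); (2,3); (3,0); (1,5); (2,4)]);
      (6, [:: (0,1); (1,2); (2,3); (3,0); (2,4); (1,5); (3,5)]);
      (7, [:: (0,1); (1,2); (2,3); (3,4); (2,5); (3,6)]);
      (7, [:: (0,1); (1,2); (2,3); (3,0); (2,4); (4,5); (4,6)]);
      (5, cycle_edges 5 ++ [:: (0, 2)]);
      (5, cycle_edges 5 ++ [:: (0, 2); (0, 3)]);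
      (5, cycle_edges 5 ++ [:: (0, 2); (1, 3)]);
      (5, cycle_edges 5 ++ [:: (0, 3); (1, 4); (2, 4)]);
      (6, cycle_edges 6 ++ [:: (0, 3)]);
      (6, cycle_edges 6 ++ [:: (1, 4)]);
      (6, cycle_edges 6 ++ [:: (2, 5)]);
      (6, cycle_edges 6 ++ [:: (0, 3); (1, 4)]);
      (6, cycle_edges 6 ++ [:: (0, 3); (2, 5)]);
      (6, cycle_edges 6 ++ [:: (1, 4); (2, 5)]);
      (6, cycle_edges 6 ++ [:: (0, 3); (1, 4); (2, 5)]);
      (5, cycle_edges 5)].

Lemma catalogue_ok : all (fun p => [&& fin_not_tricolorable p.1 p.2,
  fin_colorable4 p.1 p.2 & fin_del_tricolorable p.1 p.2]) catalogue.
Proof. by vm_compute. Qed.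

Definition listed (s4 : nat) (G : sgraph) : Prop :=
  graph_iso G (complete_graph 4) \/ in_H_family G \/ in_C5_family G \/
  in_C6_family G \/ in_D_family s4 G \/ in_G2_family G.

Lemma catalogue_listed s4 G p : p \in catalogue ->
  graph_iso G (edges_graph p.1 p.2) -> listed s4 G.
Proof.
have C6 ch : ch != [::] -> subseq ch [:: (0, 3); (1, 4); (2, 5)] ->
    graph_iso G (edges_graph 6 (cycle_edges 6 ++ ch)) -> listed s4 G.
  by move=> n0 sub Gi; do 3!right; left; exists ch.
rewrite /catalogue in_cons => /predU1P[-> Gi|]; first by left.
rewrite in_cons => /predU1P[-> Gi|]; first by right; left; apply: Or41; apply: Or41.
rewrite in_cons => /predU1P[-> Gi|]; first by right; left; apply: Or41; apply: Or42.
rewrite in_cons => /predU1P[-> Gi|]; first by right; left; apply: Or41; apply: Or43.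
rewrite in_cons => /predU1P[-> Gi|]; first by right; left; apply: Or41; apply: Or44.
rewrite in_cons => /predU1P[-> Gi|]; first by right; left; apply: Or42.
rewrite in_cons => /predU1P[-> Gi|]; first by right; left; apply: Or43.
rewrite in_cons => /predU1P[-> Gi|]; first by right; left; apply: Or44; left.
rewrite in_cons => /predU1P[-> Gi|]; first by right; left; apply: Or44; right.
rewrite in_cons => /predU1P[-> Gi|]; first by do 2!right; left; apply: Or41.
rewrite in_cons => /predU1P[-> Gi|]; first by do 2!right; left; apply: Or42.
rewrite in_cons => /predU1P[-> Gi|]; first by do 2!right; left; apply: Or43.
rewrite in_cons => /predU1P[-> Gi|]; first by do 2!right; left; apply: Or44.
do 7![rewrite in_cons => /predU1P[-> Gi|]; first exact: C6 Gi].
rewrite inE => /eqP-> Gi; do 4!right; left; exists 5; split=> //.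
exact: Or31.
Qed.

Section Detection.
Variable (G : sgraph).

(** Only the part of the adjacency matrix above the diagonal is kept, so that
    each unknown adjacency occurs once and can be split into cases. *)
Fixpoint upper (s : seq G) : seq (seq bool) :=
  if s is x :: t then [seq adj x y | y <- t] :: upper t else [::].

Definition entry (M : seq (seq bool)) : rel nat := fun i j =>
  if i < j then nth false (nth [::] M i) (j - i.+1)
  else if j < i then nth false (nth [::] M j) (i - j.+1) else false.

Lemma entry_upper x0 (s : seq G) i j : i < size s -> j < size s ->
  adj (nth x0 s i) (nth x0 s j) = entry (upper s) i j.
Proof.
have lt t a b : a < b -> b < size t ->
    adj (nth x0 t a) (nth x0 t b) = nth false (nth [::] (upper t) a) (b - a.+1).
  elim: t a b => [|x t IH] [|a] [|b] //= ab bt; last by rewrite IH // subSS.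
  by rewrite subn1 (nth_map x0).
move=> si sj; rewrite /entry; case: ltngtP => [ij|ji|->].
- exact: lt.
- by rewrite adjC lt.
by rewrite adj_irr.
Qed.

(** The images are chosen one vertex at a time, so that a partial map that
    already fails to be an induced embedding is not extended. *)
Fixpoint embeddings (e : rel nat) (n : nat) (f : rel nat) (m : nat) :=
  if m is k.+1 then
    let r := [seq f i k | i <- iota 0 k] in
    [seq rcons t v | t <- embeddings e n f k, v <- [seq v <- iota 0 n |
      if v \in t then false else [seq e a v | a <- t] == r]]
  else [:: [::]].

Lemma embeddingsP e n f m t : t \in embeddings e n f m ->
  [/\ size t = m, uniq t, all (gtn n) t &
      forall i j, i < j -> j < m -> e (nth 0 t i) (nth 0 t j) = f i j].
Proof.
elim: m t => [|m IH] t; first by rewrite inE => /eqP->.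
case/allpairsPdep=> t' [v [/IH [st ut at_ eP]]].
rewrite mem_filter mem_iota add0n; case: ifP => // /negbT vt /andP[/eqP vP /= vn] ->.
rewrite size_rcons st rcons_uniq vt ut all_rcons at_ /= vn; split=> // i j ij.
rewrite ltnS leq_eqVlt => /orP[/eqP jm|jm]; rewrite !nth_rcons st.
  rewrite jm ltnn eqxx -jm ij jm; rewrite jm in ij.
  have := congr1 (fun r => nth false r i) vP.
  rewrite (nth_map 0) ?st // => ->.
  by rewrite (nth_map 0) ?size_iota // nth_iota.
by rewrite jm (ltn_trans ij jm) eP.
Qed.

(** The search is written with a match because a boolean disjunction would
    evaluate all tests under call by value. *)
Definition detect (n : nat) (M : seq (seq bool)) : bool :=
  (fix search ps := if ps is p :: ps' then
     if embeddings (entry M) n (edge_rel p.2) p.1 is _ :: _ then true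
     else search ps' else false) catalogue.

Lemma detect_listed s4 (s : seq G) : critical133 G -> uniq s ->
  detect (size s) (upper s) -> listed s4 G.
Proof.
move=> Gc us; rewrite /detect => D.
have {D} [[m E] pc] : exists2 p, p \in catalogue & exists t,
    t \in embeddings (entry (upper s)) (size s) (edge_rel p.2) p.1.
  elim: catalogue D => // p ps IH; case Et: (embeddings _ _ _ _) => [|t ts].
    by case/IH=> q qps qt; exists q; rewrite // in_cons qps orbT.
  by exists p; [rewrite mem_head|exists t; rewrite Et mem_head].
case=> t Et.
have /embeddingsP[/= st ut at_ eP] := Et.
have /andP[nt _] := allP catalogue_ok _ pc.
case: s us at_ eP {Et} => [_|x0 s' us at_ eP].
  case: t st {ut} => [m0 _|? ? _ /andP[]//]; move: nt; rewrite -m0.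
  by move/fin_not_tricolorableP; case; exists (fun=> 0) => // -[].
set s := x0 :: s' in us at_ eP *.
have tn (i : 'I_m) : nth 0 t i < size s by apply: (allP at_); rewrite mem_nth // st.
apply: catalogue_listed pc _; apply: (critical_iso Gc
  (f := (fun i : 'I_m => nth x0 s (nth 0 t i)) : edges_graph m E -> G)).
- exact: fin_not_tricolorableP.
- move=> i j /eqP; rewrite nth_uniq //; rewrite nth_uniq ?st // => /eqP.
  exact: val_inj.
have lt (i j : 'I_m) : i < j ->
    adj (nth x0 s (nth 0 t i)) (nth x0 s (nth 0 t j)) = edge_rel E i j.
  by move=> ij; rewrite entry_upper ?eP.
move=> i j; case: (ltngtP i j) => [ij|ji|/val_inj->].
- exact: lt.
- by rewrite adjC lt // [RHS]adjC.
by rewrite !adj_irr.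
Qed.

End Detection.

(** * Triangles, and adjacent vertices of degree at least 3 *)

Ltac distinct := rewrite /= !inE ?negb_or ?andbT; repeat (apply/andP; split);
  first [done | exact: adj_neq | by rewrite eq_sym
        | by rewrite eq_sym; apply: adj_neq].

(** Walk from the edge towards the set and stop just before entering it. *)
Lemma edge_near (G : sgraph) (T : pred G) (r u v : G) n :
    walk n u r -> T r -> ~~ T u -> ~~ T v -> adj u v ->
  exists t z w, [/\ T t, ~~ T z, ~~ T w, adj t z & adj z w].
Proof.
elim: n u v => [|n IH] u v; first by move/eqP-> => ->.
case/existsP=> x /andP[ux xr] Tr Tu Tv uv.
have [Tx|Tx] := boolP (T x); first by exists x, u, v; rewrite adjC.
by apply: (IH x u) => //; rewrite adjC.
Qed.

Section SmallCases.
Variables (s4 : nat) (G : sgraph).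
Hypothesis Gc : critical133 G.

(** An edge disjoint from a triangle can be moved next to it; the five vertices
    then cannot be colored with three colors, whatever the other adjacencies
    between them. *)
Lemma triangle_edge_listed (a b c u v : G) :
  adj a b -> adj b c -> adj a c -> adj u v ->
  (forall x, x \in [:: a; b; c] -> (x != u) && (x != v)) -> listed s4 G.
Proof.
move=> ab bc ac uv dis; pose T := [in [:: a; b; c]].
have [n ua] := critical_connected Gc a u.
have Tu : ~~ T u by apply/negP=> /dis; rewrite eqxx.
have Tv : ~~ T v by apply/negP=> /dis; rewrite eqxx andbF.
have [|t [z [w [tT zT wT tz zw]]]] := edge_near ua _ Tu Tv uv.
  by rewrite /T /= inE eqxx.
have U : uniq [:: a; b; c; z; w].
  move: zT wT; rewrite /T /= !inE !negb_or !(eq_sym z) !(eq_sym w).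
  rewrite !(adj_neq ab, adj_neq bc, adj_neq ac, adj_neq zw) /=.
  by move=> /and3P[-> -> ->] /and3P[-> -> ->].
apply: (detect_listed s4 Gc U); rewrite /= ab bc ac zw.
have : [|| adj a z, adj b z | adj c z].
  by move: tT tz; rewrite /T /= !inE => /or3P[] /eqP-> ->; rewrite ?orbT.
case: (adj a z); case: (adj b z); case: (adj c z); case: (adj a w);
  case: (adj b w); case: (adj c w) => // _; by vm_compute.
Qed.

(** If no two vertices of the triangle meet all edges and every edge meets the
    triangle, then each of its vertices has a neighbor outside; three distinct
    such neighbors give a graph on six vertices that contains the net. *)
Lemma triangle_listed (a b c : G) :
  adj a b -> adj b c -> adj a c -> listed s4 G.
Proof.
move=> ab bc ac.
have cover (x y : G) : adj x y -> exists u v,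
    [/\ adj u v, u != x, u != y, v != x & v != y].
  move=> xy; have [/existsP[u /existsP[v /and5P[uv ux uy vx vy]]]|ne] :=
    boolP [exists u, exists v, [&& adj u v, u != x, u != y, v != x & v != y]].
    by exists u, v.
  case: Gc.1; apply: (cover2_tricolorable (adj_neq xy)) => u v uv.
  apply: contraR ne; rewrite !negb_or => /and4P[ux uy vx vy].
  by apply/existsP; exists u; apply/existsP; exists v; rewrite uv ux uy vx vy.
have out (x y z : G) : adj x y -> adj y z -> adj x z ->
    exists w, [/\ adj z w, w != x & w != y] \/ listed s4 G.
  move=> xy yz xz; have [u [v [uv ux uy vx vy]]] := cover x y xy.
  have [uz|uz] := eqVneq u z; first by exists v; left; rewrite -uz.
  have [vz|vz] := eqVneq v z; first by exists u; left; rewrite -vz adjC.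
  exists x; right; apply: (triangle_edge_listed xy yz xz uv) => t.
  by rewrite !inE => /or3P[] /eqP->; rewrite ![_ == u]eq_sym ![_ == v]eq_sym;
     apply/andP.
have [wc [[cw wca wcb]|//]] := out a b c ab bc ac.
have [wb [[bw wba wbc]|//]] := out a c b ac ltac:(by rewrite adjC) ab.
have [wa [[aw wab wac]|//]] := out b c a bc ltac:(by rewrite adjC) ltac:(by rewrite adjC).
(* Two triangle vertices sharing an outer neighbor give a triangle disjoint
   from the outer edge of the third, unless that edge ends there too. *)
have share (x y z w t : G) : adj x y -> adj y z -> adj x z -> adj x w -> adj y w ->
    adj z t -> z != w -> t != x -> t != y -> listed s4 G.
  move=> xy yz xz xw yw zt zw tx ty.
  have [tw|tw] := eqVneq t w.
    have U : uniq [:: x; y; z; w].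
      by distinct.
    apply: (detect_listed s4 Gc U); rewrite /= xy xz yz xw yw -tw zt.
    by vm_compute.
  apply: (triangle_edge_listed xy yw xw zt) => s.
  rewrite !inE => /or3P[] /eqP->; last by rewrite eq_sym zw eq_sym.
    by rewrite (adj_neq xz) eq_sym.
  by rewrite (adj_neq yz) eq_sym.
have [ab_|wab_] := eqVneq wa wb.
  have bwa : adj b wa by rewrite ab_.
  by apply: (share a b c wa wc ab bc ac aw bwa cw); rewrite // eq_sym.
have [cb ba ca] : [/\ adj c b, adj b a & adj c a] by split; rewrite adjC.
have [ac_|wac_] := eqVneq wa wc.
  have cwa : adj c wa by rewrite ac_.
  by apply: (share a c b wa wb ac cb ab aw cwa bw); rewrite // eq_sym.
have [bc_|wbc_] := eqVneq wb wc.
  have cwb : adj c wb by rewrite bc_.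
  by apply: (share b c a wb wa bc ca ba bw cwb aw); rewrite // eq_sym.
have U : uniq [:: a; b; c; wa; wb; wc].
  by distinct.
apply: (detect_listed s4 Gc U); rewrite /= ab bc ac aw bw cw.
by case: (adj a wb); case: (adj a wc); case: (adj b wa); case: (adj b wc);
  case: (adj c wa); case: (adj c wb); case: (adj wa wb); case: (adj wa wc);
  case: (adj wb wc); vm_compute.
Qed.

Lemma branch_third (v y z : G) : branch v ->
  exists a, [/\ adj v a, a != y & a != z].
Proof.
case/(branch_other y) => a [b [va vb ab ay bY]].
have [az|az] := eqVneq a z; last by exists a.
by exists b; split=> //; rewrite eq_sym -az.
Qed.

Hypothesis triangle_free : forall a b c : G, adj b a -> adj b c -> adj a c = false.

(** The neighbors of [x] and [y], with one further edge [z w] at a neighbor of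
    [x], already leave no coloring with three colors. If [w] is adjacent to
    [y], it can play the role of one of the neighbors of [y] and six vertices
    are enough. *)
Lemma double_star_listed (x y z w : G) : branch x -> branch y -> adj x y ->
  adj x z -> adj z w -> z != y -> w != x -> w != y -> listed s4 G.
Proof.
move=> bx by_ xy xz zw zy wx wy.
have [p [xp py pz]] := branch_third y z bx.
have [yx zx] : adj y x /\ adj z x by split; rewrite adjC.
have xw := triangle_free zx zw.
have wp : w != p by apply: contraFneq xw => ->.
have yz := triangle_free xy xz; have yp := triangle_free xy xp.
have zp := triangle_free xz xp.
have nbr q : adj y q -> q != x -> [/\ adj x q = false, q != z & q != p].
  move=> yq qx; split; first exact: triangle_free yx yq.
    by apply: contraTneq yq => ->; rewrite yz.
  by apply: contraTneq yq => ->; rewrite yp.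
have [yw|yw] := boolP (adj y w).
  have [q [yq qx qw]] := branch_third x w by_.
  have [xq qz qp] := nbr q yq qx.
  have wq := triangle_free yw yq.
  have U : uniq [:: x; y; z; p; w; q] by distinct.
  apply: (detect_listed s4 Gc U).
  rewrite /= xy xz xp xw xq yz yp yw yq zp zw wq.
  by case: (adj z q); case: (adj p w); case: (adj p q); vm_compute.
have [q [r [yq yr qr qx rx]]] := branch_other x by_.
have [xq qz qp] := nbr q yq qx; have [xr rz rp] := nbr r yr rx.
have qw : q != w by apply: contraTneq yq => ->.
have rw : r != w by apply: contraTneq yr => ->.
have U : uniq [:: x; y; z; p; w; q; r] by distinct.
apply: (detect_listed s4 Gc U).
rewrite /= xy xz xp xw xq xr yz yp (negPf yw) yq yr zp zw (triangle_free yq yr).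
by case: (adj z q); case: (adj z r); case: (adj p w); case: (adj p q);
  case: (adj p r); case: (adj w q); case: (adj w r); vm_compute.
Qed.

(** Either the edge [x y] meets every edge, and its ends can take the two
    colors 2 and 3, or an edge leaves the double star around it. *)
Lemma branch_edge_listed (x y : G) :
  branch x -> branch y -> adj x y -> listed s4 G.
Proof.
move=> bx by_ xy; pose T := [pred v | (v == x) || (v == y)].
have [/existsP[u /existsP[v /and3P[uv Tu Tv]]]|ne] :=
    boolP [exists u, exists v, [&& adj u v, ~~ T u & ~~ T v]]; last first.
  case: Gc.1; apply: (cover2_tricolorable (adj_neq xy)) => u v uv.
  apply: contraR ne => nT; apply/existsP; exists u; apply/existsP; exists v.
  by rewrite uv -negb_or /= -orbA.
have [n ux] := critical_connected Gc x u.
have [|t [z [w [/orP tT zT wT tz zw]]]] := edge_near ux _ Tu Tv uv.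
  by rewrite /= eqxx.
move: zT wT; rewrite /= !negb_or => /andP[zx zy] /andP[wx wy].
case: tT => /eqP tE; rewrite tE in tz.
  exact: (double_star_listed bx by_ xy tz zw).
by apply: (double_star_listed by_ bx _ tz zw); rewrite // adjC.
Qed.

End SmallCases.

(** * Levels of a graph whose cycles have length divisible by 4 *)

Lemma bfs (G : sgraph) (r : G) : (forall v, exists n, walk n v r) ->
  exists (lev : G -> nat) (par : G -> G),
    [/\ lev r = 0, forall v, lev v = 0 -> v = r,
        forall v, v != r -> adj v (par v) /\ lev v = (lev (par v)).+1 &
        forall u v, adj u v -> lev u <= (lev v).+1].
Proof.
move=> con; pose lev v := ex_minn (con v).
have levW v : walk (lev v) v r by rewrite /lev; case: ex_minnP.
have lev_min n v : walk n v r -> lev v <= n.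
  by move=> vr; rewrite /lev; case: ex_minnP => m _; apply.
have levS u v : adj u v -> lev u <= (lev v).+1.
  by move=> uv; apply: lev_min; apply: walkS uv (levW v).
pose par v := odflt v [pick w | adj v w && (lev v == (lev w).+1)].
exists lev, par; split=> // [|v v0|v vr].
- by apply/eqP; rewrite -leqn0; apply: lev_min; rewrite /= eqxx.
- by apply/eqP; have := levW v; rewrite v0.
rewrite /par; case: pickP => [w /andP[vw /eqP E] //|no].
have := levW v; case E: (lev v) => [|n]; first by rewrite /= (negPf vr).
case/existsP=> w /andP[vw wr]; have := no w; rewrite vw E eqSS /=.
by have := levS v w vw; have := lev_min n w wr; rewrite E; lia.
Qed.

Section Levels.
Variables (G : sgraph) (r : G) (lev : G -> nat) (par : G -> G).
Hypothesis lev_r : lev r = 0.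
Hypothesis lev0 : forall v, lev v = 0 -> v = r.
Hypothesis parP : forall v, v != r -> adj v (par v) /\ lev v = (lev (par v)).+1.
Hypothesis levS : forall u v, adj u v -> lev u <= (lev v).+1.
Hypothesis cyc4 : forall n (f : nat -> G), 2 < n -> cyc n f -> 4 %| n.

Let up i v := iter i par v.

Lemma lev_up i v : i <= lev v -> lev (up i v) = lev v - i.
Proof.
elim: i => [|i IH] iv; first by rewrite subn0.
have := IH ltac:(lia); rewrite /up /=; set w := iter i par v => wE.
have [|_] := parP (v := w); last by lia.
by apply/eqP => wr; move: wE; rewrite wr lev_r; lia.
Qed.

Lemma adj_up i v : i < lev v -> adj (up i v) (up i.+1 v).
Proof.
move=> iv; have [|//] := parP (v := up i v).
by apply/eqP=> E; have := lev_up (ltnW iv); rewrite E lev_r; lia.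
Qed.

(** Following parents from two vertices of the same level until the tours
    first meet gives two internally disjoint paths. *)
Lemma meet u v : u != v -> lev u = lev v -> exists t,
  [/\ 0 < t, t <= lev u, up t u = up t v & forall i, i < t -> up i u != up i v].
Proof.
move=> uv luv; have root w : up (lev w) w = r.
  by apply: lev0; rewrite lev_up // subnn.
have ex : exists t, up t u == up t v by exists (lev u); rewrite {2}luv !root.
case: (ex_minnP ex) => t /eqP tE t_min; exists t; split=> //.
- by case: t tE {t_min} => // tE; case/eqP: uv; exact: tE.
- by apply: t_min; rewrite {2}luv !root.
by move=> i; rewrite ltnNge; apply: contra => /t_min.
Qed.

(** The tour goes up from [u] to the meeting point in [t] steps, down to [v] in
    [t] more steps, and may end in one further vertex [x]. *)
Definition tour t u v x i :=
  if i <= t then up i u else if i <= t.*2 then up (t.*2 - i) v else x.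

Section Tour.
Variables (t : nat) (u v x : G).
Hypotheses (t0 : 0 < t) (tu : t <= lev u) (luv : lev u = lev v).
Hypotheses (tE : up t u = up t v) (tN : forall i, i < t -> up i u != up i v).

Lemma tour_lev i : i <= t.*2 ->
  lev (tour t u v x i) = lev u - (if i <= t then i else t.*2 - i).
Proof.
by move=> it; rewrite /tour it; case: ifP => ti; rewrite lev_up ?luv //; lia.
Qed.

Lemma tour_inj i j : i < j -> j <= t.*2 -> tour t u v x i <> tour t u v x j.
Proof.
move=> ij jt E; have := tour_lev jt; rewrite -E tour_lev; last lia.
move=> l; have [it jt' ij'] : [/\ i < t, t < j & t.*2 - j = i].
  by split; move: l; do 2![case: ifP]; lia.
move: E; rewrite /tour (ltnW it) jt leqNgt jt' /= ij' => E.
by have := tN it; rewrite E eqxx.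
Qed.

Lemma tour_adj i : i < t.*2 -> adj (tour t u v x i) (tour t u v x i.+1).
Proof.
move=> it; rewrite /tour it (ltnW it); case: (ltngtP i t) => it'.
- by apply: adj_up; lia.
- have -> : t.*2 - i = (t.*2 - i.+1).+1 by lia.
  by rewrite adjC; apply: adj_up; lia.
rewrite it' tE; have -> : t.*2 - t.+1 = t.-1 by lia.
by rewrite -{1}(prednK t0) adjC; apply: adj_up; lia.
Qed.

Lemma tour_last : tour t u v x t.*2 = v.
Proof. by rewrite /tour leqnn subnn; case: leqP => // ; lia. Qed.

Lemma tour_end : tour t u v x t.*2.+1 = x.
Proof. by rewrite /tour ltnn; case: leqP => //; lia. Qed.

End Tour.

(** An edge inside a level would close the tour to an odd cycle. *)
Lemma level_indep u v : lev u = lev v -> ~~ adj u v.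
Proof.
move=> luv; apply/negP=> uv; have [t [t0 tu tE tN]] := meet (adj_neq uv) luv.
suff /cyc4 : cyc t.*2.+1 (tour t u v u) by lia.
apply: cycI => // [i it||i j ij jt].
- exact: tour_adj.
- by rewrite /= tour_last // adjC.
exact: tour_inj.
Qed.

Lemma adj_odd u v : adj u v -> odd (lev u) = ~~ odd (lev v).
Proof.
move=> uv; have : lev u != lev v by apply/eqP=> /level_indep; rewrite uv.
by have := levS uv; have := @levS v u; rewrite adjC uv => /(_ isT); lia.
Qed.

Hypothesis branch_even : forall v, branch v -> ~~ odd (lev v).

(** Two vertices of the same even level have no common neighbor. A common
    parent would have degree at least 3 on an odd level. With a common child,
    the tours from the two vertices meet after [t] steps in a cycle of length
    [2 * t + 2], so [t] is odd; then the meeting point lies on an odd level, and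
    its own parent makes it a vertex of degree at least 3. *)
Lemma even_level_indep u v x : u != v -> lev u = lev v -> ~~ odd (lev u) ->
  adj u x -> adj x v -> False.
Proof.
move=> uv luv ev ux xv; have ox : odd (lev x).
  by have := adj_odd ux; lia.
have xr : x != r by apply: contraTneq ox => ->; rewrite lev_r.
have [xp lx] := parP xr; have xu : adj x u by rewrite adjC.
have [lt|ge] := ltnP (lev x) (lev u).
  have : branch x.
    apply: (branchI xu xv xp) => //; apply/eqP=> E; move: lx lt; rewrite -E; lia.
  by move/branch_even; rewrite ox.
have lxu : lev x = (lev u).+1 by have := levS xu; move: ge ox ev; lia.
have [t [t0 tu tE tN]] := meet uv luv.
have tp : t.-1 < lev u by rewrite prednK.
have lS : lev u - t.-1 = (lev u - t).+1 by clear -t0 tu; lia.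
have nS m : m <> m.+2 by lia.
have C : cyc t.*2.+2 (tour t u v x).
  apply: cycI => // [i it||i j ij jt].
  - have [i2|i2] := ltnP i t.*2; first exact: tour_adj.
    have -> : i = t.*2 by lia.
    by rewrite tour_last // tour_end // adjC.
  - by rewrite /= tour_end.
  have [j2|j2] := leqP j t.*2; first exact: tour_inj.
  have -> : j = t.*2.+1 by lia.
  rewrite tour_end // => /(congr1 lev); rewrite tour_lev //; lia.
have ot : odd t by have := cyc4 _ C; lia.
set z := up t u; have lz : lev z = lev u - t by rewrite lev_up.
have oz : odd (lev z) by lia.
have zr : z != r by apply: contraTneq oz => ->; rewrite lev_r.
have [zp lp] := parP zr.
suff /branch_even : branch z by rewrite oz.
pose a := up t.-1 u; pose b := up t.-1 v.
have za : adj z a by rewrite adjC /z -(prednK t0); apply: adj_up.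
have zb : adj z b by rewrite adjC /z tE -(prednK t0); apply: adj_up; rewrite -luv.
have la : lev a = (lev z).+1 by rewrite lz -lS lev_up // ltnW.
have lb : lev b = (lev z).+1 by rewrite lz -lS lev_up -luv // ltnW.
apply: (branchI za zb zp).
- by apply: tN; rewrite prednK.
- by apply/eqP=> E; move: la; rewrite E lp; apply: nS.
by apply/eqP=> E; move: lb; rewrite E lp; apply: nS.
Qed.

Lemma levels_tricolorable : tricolorable G.
Proof.
apply: (labelled_tricolorable (d := lev)) => [u v uv|u v x].
  have := adj_odd uv; have := levS uv; have := @levS v u.
  by rewrite adjC => /(_ uv); lia.
exact: even_level_indep.
Qed.

End Levels.

(** * The graphs G_{2k} *)

(** Among three neighbors of a vertex of color 1, all at mutual distance at
    most 2, two would share the color 2 or 3. *)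
Lemma branch_color (G : sgraph) (c : G -> nat) (v : G) :
  (forall u, c u < 3) -> spaced133 c -> branch v -> c v != 0.
Proof.
move=> c3 cP /existsP[x /existsP[y /existsP[z]]].
case/and5P=> xy xz yz vx /andP[vy vz]; apply/eqP=> v0.
have nb a : adj v a -> c a != 0.
  move=> va; apply/eqP=> a0; have [] := cP v a (adj_neq va).
    by rewrite a0.
  by rewrite va.
have ne a b : adj v a -> adj v b -> a != b -> c a <> c b.
  move=> va vb ab cab; have [_ /(_ (nb a va) 2)] := cP a b ab cab.
  by move=> H; suff /H : walk 2 a b by []; apply/walk2P; exists v; rewrite // adjC.
have := ne _ _ vx vy xy; have := ne _ _ vx vz xz; have := ne _ _ vy vz yz.
have := nb x vx; have := nb y vy; have := nb z vz.
have := c3 x; have := c3 y; have := c3 z; lia.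
Qed.

(** Vertices of degree at least 3 avoid the color 1, whereas the two ends of an
    odd number of steps along a trail cannot both avoid it. *)
Lemma fork_not_tricolorable (G : sgraph) (f : nat -> G) L :
    (forall i, i.+1 < L -> adj (f i) (f i.+1)) ->
    (forall i j, i < j -> j <= i + 3 -> j < L -> f i != f j) ->
    5 < L -> ~~ odd L -> branch (f 1) -> branch (f L.-2) ->
  ~ tricolorable G.
Proof.
move=> fS fI L5 eL b1 b2 [c c3 cP].
have [_ alt_] := @trail_colors G c f 0 L cP (fun i _ _ => c3 (f i))
  (fun i _ => fS i) (fun i j _ ij ji => fI i j ij ji) (ltnW L5).
have alt i : i.+1 < L -> (c (f i) == 0) = (c (f i.+1) != 0) := alt_ i isT.
have nz1 := branch_color c3 cP b1; have nz2 := branch_color c3 cP b2.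
have par i : i.*2.+1 < L -> c (f i.*2.+1) != 0.
  elim: i => [//|i IH] iL; rewrite -alt; last by lia.
  by rewrite -[_ == 0]negbK doubleS -alt ?IH //; lia.
have := par (L.-2./2.-1); have E : (L.-2./2.-1).*2.+1 = L.-2.-1 by lia.
rewrite E => /(_ ltac:(lia)); have := alt L.-2.-1 ltac:(lia).
by rewrite prednK ?nz2; [move=> ->|lia].
Qed.

(** With the length [m = 2k - 3] of the path as parameter, adjacency involves no
    truncated subtraction. *)
Definition G2_lt m i j : bool :=
  [|| (j == i.+1) && (j <= m), (i == 0) && ((j == m.+1) || (j == m.+2)) |
      (i == m) && ((j == m.+3) || (j == m.+4))].

Definition G2_index k (u : G2 k) : nat := nat_of_ord (u : 'I_(2 * k + 2)).
Arguments G2_index {k} u.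

Section G2.
Variables k m : nat.
Hypotheses (m3 : 2 < m) (km : 2 * k = m + 3).

Lemma G2_index_inj : injective (@G2_index k).
Proof. exact: val_inj. Qed.

Lemma G2_index_lt (u : G2 k) : G2_index u < 2 * k + 2.
Proof. exact: ltn_ord. Qed.

Lemma G2_adjE (u v : G2 k) : G2_index u < G2_index v ->
  adj u v = G2_lt m (G2_index u) (G2_index v).
Proof.
have pe a b n : ((a, b) \in path_edges n) = (b == a.+1) && (a < n.-1).
  apply/mapP/andP=> [[i + [-> ->]]|[/eqP-> an]].
    by rewrite mem_iota.
  by exists a; rewrite ?mem_iota.
rewrite /= /edges_adj -val_eqE /= !mem_cat !pe !inE !xpair_eqE /G2_lt.
rewrite -/(G2_index u) -/(G2_index v); move: (G2_index u) (G2_index v) => a b ab.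
have -> : 2 * k - 2 = m.+1 by lia.
have -> : 2 * k - 1 = m.+2 by lia.
have -> : 2 * k - 3 = m by lia.
have -> : 2 * k = m.+3 by lia.
have -> : m.+3 + 1 = m.+4 by lia.
rewrite (ltn_eqF ab) /=.
have -> : (a == b.+1) = false by lia.
have -> : (b == 0) = false by lia.
have -> : (b == m) && (a == m.+3) = false by lia.
have -> : (b == m) && (a == m.+4) = false by lia.
case: (a == 0); case: (a == m); case: (b == m.+1); case: (b == m.+2);
  case: (b == m.+3); case: (b == m.+4); rewrite ?orbT ?orbF //=;
  case: eqP => //=; lia.
Qed.

Lemma G2_adj_cases (u v : G2 k) : adj u v ->
  G2_lt m (G2_index u) (G2_index v) && (G2_index u < G2_index v) \/
  G2_lt m (G2_index v) (G2_index u) && (G2_index v < G2_index u).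
Proof.
case: (ltngtP (G2_index u) (G2_index v)) => uv.
- by rewrite G2_adjE // andbT; left.
- by rewrite adjC G2_adjE // andbT; right.
by rewrite (val_inj uv : u = v) adj_irr.
Qed.

Let n0 : 0 < 2 * k + 2. Proof. by rewrite addn2. Qed.
Definition G2_vertex i : G2 k := Ordinal (ltn_pmod i n0).

Let km5 : 2 * k + 2 = m + 5. Proof. lia. Qed.

Lemma G2_vertexE i : i < m + 5 -> G2_index (G2_vertex i) = i.
Proof. by move=> ik; rewrite /= modn_small // km5. Qed.

Lemma G2_vertex_adj i j : i < j -> j < m + 5 ->
  adj (G2_vertex i) (G2_vertex j) = G2_lt m i j.
Proof.
move=> ij jk; have ik := ltn_trans ij jk.
by rewrite G2_adjE !G2_vertexE.
Qed.

Lemma G2_vertex_neq i j : i < m + 5 -> j < m + 5 -> i != j ->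
  G2_vertex i != G2_vertex j.
Proof. by move=> ik jk; rewrite -val_eqE /= !modn_small ?km5. Qed.

Lemma G2_branch0 : branch (G2_vertex 0).
Proof.
apply: (branchI (a := G2_vertex 1) (b := G2_vertex m.+1) (c := G2_vertex m.+2));
  rewrite ?G2_vertex_adj /G2_lt ?G2_vertex_neq ?eqxx ?orbT //; lia.
Qed.

Lemma G2_branchm : branch (G2_vertex m).
Proof.
apply: (branchI (a := G2_vertex m.-1) (b := G2_vertex m.+3) (c := G2_vertex m.+4));
  rewrite 1?[adj _ (G2_vertex m.-1)]adjC ?G2_vertex_adj /G2_lt
    ?G2_vertex_neq ?eqxx ?orbT //; lia.
Qed.

Lemma G2_not_tricolorable : ~ tricolorable (G2 k).
Proof.
pose h i := if i is j.+1 then if j <= m then j else m.+3 else m.+1.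
have h1 : h m.+1 = m by rewrite /h leqnn.
apply: (@fork_not_tricolorable _ (fun i => G2_vertex (h i)) m.+3); cbv beta.
- case=> [|i] ik; first by rewrite adjC G2_vertex_adj /G2_lt /= ?eqxx //; lia.
  rewrite /h; have -> : i <= m by lia.
  case: (leqP i.+1 m) => im; rewrite G2_vertex_adj /G2_lt ?eqxx //=; lia.
- move=> i j ij ji jk; apply: G2_vertex_neq.
  + by case: i ij ji => [|i] *; rewrite /h; [lia|case: ifP; lia].
  + by case: j jk ij ji => [|j] *; rewrite /h; [lia|case: ifP; lia].
  case: i j ij ji jk => [|i] [|j] // ij ji jk; rewrite /h; do ?[case: ifP => ?]; lia.
- by lia.
- by lia.
- exact: G2_branch0.
by rewrite h1; apply: G2_branchm.
Qed.

(** It suffices to label the vertices in such a way that labels differ by one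
    along each edge, and that the even labels occur only once. *)
Lemma G2_labelled (a : nat) (lab : nat -> nat) :
    (forall i j, i != a -> j != a -> i < j -> j < m + 5 -> G2_lt m i j ->
       lab i = (lab j).+1 \/ lab j = (lab i).+1) ->
    (forall i j, i != a -> j != a -> i < j -> j < m + 5 -> lab i = lab j ->
       odd (lab i)) ->
  forall u : G2 k, G2_index u = a -> tricolorable (del_vertex u).
Proof.
rewrite -km5 => labS labI u ua.
have va (x : del_vertex u) : G2_index (val x) != a.
  by rewrite -ua; apply: (valP x).
pose d (x : del_vertex u) := lab (G2_index (val x)).
apply: (@labelled_tricolorable _ d) => [x y|x y z xy E ev _ _].
  case/G2_adj_cases => /andP[H lt]; last apply/or_comm;
    apply: labS => //; exact: G2_index_lt.
case: (ltngtP (G2_index (val x)) (G2_index (val y))) => lt.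
- by case/negP: ev; apply: labI lt _ E => //; apply: G2_index_lt.
- by case/negP: ev; rewrite E; apply: labI lt _ (esym E) => //; apply: G2_index_lt.
by case/eqP: xy; apply: val_inj; apply: G2_index_inj.
Qed.

(** Deleting a pendant vertex leaves a tree in which only the other end of the
    path is a fork, and levels counted from the remaining pendant vertex of the
    damaged end work; deleting a vertex of the path separates the two forks,
    and each of them can be put on an even level. *)
Lemma G2_del_tricolorable (u : G2 k) : tricolorable (del_vertex u).
Proof.
have [a au] : exists a, G2_index u = a by exists (G2_index u).
have am : a < m + 5 by rewrite -au -km5; apply: G2_index_lt.
have om : odd m by lia.
case: (ltnP m a) => ma; first case: (ltnP m.+2 a) => ma2.
- apply: (G2_labelled (lab := fun i => if i <= m then m.+1 - i else
    if i <= m.+2 then m.+2 else 0) _ _ au) => i j ia ja ij jm.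
    by rewrite /G2_lt => H; do ?[case: ifP => ?]; lia.
  by do ?[case: ifP => ?]; lia.
- apply: (G2_labelled (lab := fun i => if i <= m then i.+1 else
    if i <= m.+2 then 0 else m.+2) _ _ au) => i j ia ja ij jm.
    by rewrite /G2_lt => H; do ?[case: ifP => ?]; lia.
  by do ?[case: ifP => ?]; lia.
apply: (G2_labelled (lab := fun i => if i < a then i.+2 else
  if i <= m then m + m.*2 + 4 - i else if i <= m.+2 then 1 else m.*2 + 3)
  _ _ au) => i j ia ja ij jm.
  by rewrite /G2_lt => H; do ?[case: ifP => ?]; lia.
by do ?[case: ifP => ?]; lia.
Qed.

(** The fourth color on one pendant vertex resolves the only conflict in the
    levels counted from the other pendant vertex of the same end. *)
Lemma G2_colorable4 S : S 0 = 1 -> S 1 = 3 -> S 2 = 3 -> colorable S (G2 k) 4.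
Proof.
move=> S0 S1 S2; have om : odd m by lia.
pose w := G2_vertex m.+2.
pose d (x : G2 k) := let i := G2_index x in
  if i <= m then i.+1 else if i <= m.+2 then 0 else m.+2.
have wE : G2_index w = m.+2 by rewrite G2_vertexE; lia.
have sp := @labelled_spaced (G2 k) d (fun x => x != w).
apply: (colorable4_once S0 S1 S2 (w := w)
  (c := fun x => if x == w then 3 else tint (d x))).
- by move=> u /negPf->; apply: tint_lt3.
- by rewrite eqxx.
move=> u v uv; case: (eqVneq u w) => uw; case: (eqVneq v w) => vw.
- by rewrite uw vw eqxx in uv.
- by move=> E; have := tint_lt3 (d v); rewrite -E.
- by move=> E; have := tint_lt3 (d u); rewrite E.
apply: sp => // [x y /G2_adj_cases|x y z xw yw xy E ev _ _].
  have := G2_index_lt x; have := G2_index_lt y; rewrite /d !km5.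
  move: (G2_index x) (G2_index y) => i j im jm.
  by case=> /andP[]; rewrite /G2_lt => H ij; do ?[case: ifP => ?]; lia.
have := G2_index_lt x; have := G2_index_lt y; move: xw yw xy ev E.
rewrite -!(inj_eq G2_index_inj) wE /d !km5.
move: (G2_index x) (G2_index y) => i j iw jw ij.
by do ?[case: ifP => ?]; lia.
Qed.

End G2.

(** * Vertices of degree at least 3 at odd distance *)

Section OddBranches.
Variables (G : sgraph) (side : G -> bool).
Hypothesis sideP : forall u v : G, adj u v -> side u = ~~ side v.

Lemma walk_side n u v : walk n u v -> odd n = side u (+) side v.
Proof.
elim: n u => [|n IH] u; first by move/eqP->; rewrite addbb.
by case/existsP=> w /andP[/sideP-> /IH] /= ->; rewrite addNb.
Qed.

Lemma same_side_nadj u v : side u = side v -> adj u v = false.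
Proof. by move=> E; apply/negP=> /sideP; rewrite E; case: (side v). Qed.

(** [m] is the least odd length of a walk between two vertices of degree at
    least 3, and [g] is such a walk. A shortcut between two of its vertices
    would have the parity of the part that it replaces. *)
Section Geodesic.
Variables (m : nat) (g : nat -> G).
Hypothesis gS : forall i, i < m -> adj (g i) (g i.+1).

Lemma part_walk i j : i <= j -> j <= m -> walk (j - i) (g i) (g j).
Proof.
move=> ij jm; apply/walkP; exists (fun t => g (i + t)).
rewrite addn0 subnKC //; split=> // t tj; rewrite addnS; apply: gS; lia.
Qed.

Hypotheses (om : odd m) (m3 : 2 < m).
Hypotheses (b0 : branch (g 0)) (bm : branch (g m)).
Hypothesis m_min : forall n (x y : G),
  odd n -> branch x -> branch y -> walk n x y -> m <= n.

Lemma geodesic a i j : i <= j -> j <= m -> walk a (g i) (g j) -> j - i <= a.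
Proof.
move=> ij jm ga; have im := leq_trans ij jm.
have W := walk_cat (walk_cat (part_walk (leq0n i) im) ga) (part_walk jm (leqnn m)).
have W0 := part_walk (leq0n m) (leqnn m).
have oW : odd (i - 0 + a + (m - j)).
  by rewrite (walk_side W) -(walk_side W0) subn0.
have := m_min oW b0 bm W; lia.
Qed.

Lemma geodesic_neq i j : i < j -> j <= m -> g i != g j.
Proof.
by move=> ij jm; apply/negP=> /(@geodesic 0 i j (ltnW ij) jm); lia.
Qed.

Lemma geodesic_adj i j : i < j -> j <= m -> adj (g i) (g j) = (j == i.+1).
Proof.
move=> ij jm; apply/idP/eqP=> [|jE]; last by rewrite jE; apply: gS; lia.
by rewrite -walk1 => /(geodesic (ltnW ij) jm); lia.
Qed.

(** If a neighbor [p] of the first vertex were adjacent to [g 2], then [g 2]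
    would be closer to the last vertex and have degree at least 3. *)
Lemma pendant p i : adj (g 0) p -> p != g 1 -> i <= m ->
  g i != p /\ adj (g i) p = (i == 0).
Proof.
move=> gp p1 im; have g0i := part_walk (leq0n i) im.
have neq j : j <= m -> g j != p.
  move=> jm; apply/negP=> /eqP E; case: j => [|[|j]] in jm E.
  - by move: gp; rewrite -E adj_irr.
  - by rewrite E eqxx in p1.
  by move: gp; rewrite -E geodesic_adj.
split; first exact: neq.
case: (posnP i) => [->|i0]; first by rewrite gp.
apply/negP=> ip; have : walk 2 (g 0) (g i).
  by apply/walk2P; exists p; rewrite // adjC.
move=> W2; have /(_ im) := geodesic (leq0n i) _ W2; rewrite subn0 => i2.
have oi : odd (i - 0) = odd 2 by rewrite (walk_side g0i) -(walk_side W2).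
have {W2 oi g0i i0 i2} iE : i = 2 by move: oi; rewrite /=; lia.
rewrite {}iE in ip im.
have b2 : branch (g 2).
  have g21 : adj (g 2) (g 1) by rewrite adjC gS //; lia.
  apply: (branchI g21 (gS m3) ip); rewrite ?neq ?geodesic_neq //; lia.
have o2 : odd (m - 2) by lia.
by have := m_min o2 b2 bm (part_walk im (leqnn m)); lia.
Qed.

End Geodesic.

Hypothesis Gc : critical133 G.
Hypothesis cyc4 : forall n (f : nat -> G), 2 < n -> cyc n f -> 4 %| n.
Hypothesis branch_nadj : forall u v : G, branch u -> branch v -> ~~ adj u v.

Lemma odd_branches_G2 n (x y : G) :
  odd n -> branch x -> branch y -> walk n x y -> in_G2_family G.
Proof.
move=> on bx by_ xy.
have ex : exists n, odd n && [exists x : G, exists y : G,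
    [&& branch x, branch y & walk n x y]].
  exists n; rewrite on; apply/existsP; exists x; apply/existsP; exists y.
  by rewrite bx by_.
case: (ex_minnP ex) => m /andP[om /existsP[x' /existsP[y' xy']]] m_min_.
case/and3P: xy' => b0 bm /walkP[g [g0 gm gS]]; rewrite -g0 -gm in b0 bm.
have m_min l (u v : G) : odd l -> branch u -> branch v -> walk l u v -> m <= l.
  move=> ol bu bv uv; apply: m_min_; rewrite ol; apply/existsP; exists u.
  by apply/existsP; exists v; rewrite bu bv.
have m3 : 2 < m.
  case: m om b0 bm gS {m_min m_min_ gm} => [|[|[|]]] // _ b0 b1 /(_ 0 isT) g01.
  by have := branch_nadj b0 b1; rewrite g01.
have [p1 [p2 [gp1 gp2 p12 p1g p2g]]] := branch_other (g 1) b0.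
have [q1 [q2 [gq1 gq2 q12 q1g q2g]]] := branch_other (g m.-1) bm.
have pP p i := @pendant m g gS om m3 b0 bm m_min p i.
have qP q i : adj (g m) q -> q != g m.-1 -> i <= m ->
    g i != q /\ adj (g i) q = (i == m).
  move=> gq q1' im.
  have [||||||] := @pendant m (fun i => g (m - i)) _ om m3 _ _ m_min q (m - i).
  - move=> j jm; rewrite adjC -(subnSK jm); apply: gS.
    by rewrite ltn_subrL (leq_ltn_trans (leq0n 2) m3).
  - by rewrite subn0.
  - by rewrite subnn.
  - by rewrite subn0.
  - by rewrite subn1.
  - exact: leq_subr.
  rewrite subKn // => -> ->; split=> //; clear -im; lia.
have sm : side (g m) = ~~ side (g 0).
  have := walk_side (part_walk gS (leq0n m) (leqnn m)).
  by rewrite subn0 om; case: (side (g 0)); case: (side (g m)).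
have sp p : adj (g 0) p -> side p = ~~ side (g 0).
  by move/sideP->; rewrite negbK.
have sq q : adj (g m) q -> side q = side (g 0).
  by move/sideP; rewrite sm => /negb_inj.
have pqN p q : adj (g 0) p -> adj (g m) q -> p != q.
  move=> gp gq; apply/eqP=> E; have := sp p gp; rewrite E (sq q gq).
  by case: (side (g 0)).
(* For m = 3 an edge between two pendant vertices would close a 6-cycle. *)
have pq p q : adj (g 0) p -> p != g 1 -> adj (g m) q -> q != g m.-1 -> adj p q = false.
  move=> gp p1' gq q1'; apply/negP=> apq.
  have W : walk 3 (g 0) (g m).
    by apply: (walkS gp); apply/walk2P; exists q; rewrite // adjC.
  have mE : m = 3 by apply/eqP; rewrite eqn_leq m3 (m_min 3 _ _ isT b0 bm W).
  move: b0 bm gS m_min gq q1' pP qP; rewrite mE => b0' bm' gS' m_min' gq3 q13 pP3 qP3.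
  suff /cyc4 : cyc 6 (fun i => if i <= 3 then g i else if i == 4 then q else p).
    by move/(_ isT).
  apply: cycI => // [[|[|[|[|[|]]]]] //|/=|i j ij j6].
  - by move=> _; apply: (gS' 0).
  - by move=> _; apply: (gS' 1).
  - by move=> _; apply: (gS' 2).
  - by rewrite /= adjC.
  - by rewrite adjC.
  apply/eqP; case: (leqP j 3) => j3.
    by rewrite (ltnW (leq_trans ij j3)) (geodesic_neq gS' isT isT b0' bm' m_min').
  have [i3|i3] := leqP i 3.
    case: (j =P 4) => _; first by have [] := qP3 q i gq3 q13 i3.
    by have [] := pP3 p i gp p1' i3.
  have [-> ->] : i = 4 /\ j = 5 by clear -i3 ij j6; lia.
  by rewrite /= eq_sym pqN ?mE.
pose F i := if i <= m then g i else nth q2 [:: p1; p2; q1] (i - m.+1).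
have [F1 F2 F3 F4] : [/\ F m.+1 = p1, F m.+2 = p2, F m.+3 = q1 & F m.+4 = q2].
  have Fx t : F (m.+1 + t) = nth q2 [:: p1; p2; q1] t.
    by rewrite /F addKn leqNgt addSn ltnS leq_addr.
  have := (Fx 0, Fx 1, Fx 2, Fx 3).
  by rewrite addn0 addn1 addn2 addn3 => -[[[-> ->] ->] ->].
have Fg i : i <= m -> F i = g i by rewrite /F => ->.
clearbody F; have FP i j : i < j -> j < m + 5 ->
    F i != F j /\ adj (F i) (F j) = G2_lt m i j.
  move=> ij jm; case: (leqP j m) => jm'.
    have im := ltnW (leq_trans ij jm').
    rewrite !Fg // (geodesic_neq gS om m3 b0 bm m_min) //.
    rewrite (geodesic_adj gS om m3 b0 bm m_min) //; split=> //.
    by rewrite /G2_lt; clear -ij jm' m3; lia.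
  case: (leqP i m) => im; last first.
    have ss u v : side u = side v -> adj u v = false := @same_side_nadj u v.
    have -> : G2_lt m i j = false by rewrite /G2_lt; clear -im ij m3; lia.
    have : [\/ i = m.+1 /\ j = m.+2, i = m.+3 /\ j = m.+4 |
      (i = m.+1 \/ i = m.+2) /\ (j = m.+3 \/ j = m.+4)].
      clear -im ij jm; have [i1|i1] := leqP i m.+2.
        by have [j1|j1] := leqP j m.+2; [apply: Or31|apply: Or33]; lia.
      by apply: Or32; lia.
    case=> [[-> ->]|[-> ->]|[iE jE]].
    - by rewrite F1 F2; split=> //; apply: ss; rewrite (sp _ gp1) (sp _ gp2).
    - by rewrite F3 F4; split=> //; apply: ss; rewrite (sq _ gq1) (sq _ gq2).
    by case: iE => ->; case: jE => ->; rewrite ?F1 ?F2 ?F3 ?F4;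
      (split; [exact: pqN|exact: pq]).
  rewrite (Fg i im).
  have : [\/ j = m.+1, j = m.+2, j = m.+3 | j = m.+4].
    clear -jm jm'; have : (j == m.+1) || (j == m.+2) || (j == m.+3) || (j == m.+4) by lia.
    by case/orP=> [/orP[/orP[]|]|] /eqP;
      [apply: Or41|apply: Or42|apply: Or43|apply: Or44].
  case=> jE; rewrite jE ?F1 ?F2 ?F3 ?F4.
  - by have [|-> ->] := pP p1 i gp1 p1g; rewrite // /G2_lt; split=> //; clear -im m3; lia.
  - by have [|-> ->] := pP p2 i gp2 p2g; rewrite // /G2_lt; split=> //; clear -im m3; lia.
  - by have [|-> ->] := qP q1 i gq1 q1g; rewrite // /G2_lt; split=> //; clear -im m3; lia.
  by have [|-> ->] := qP q2 i gq2 q2g; rewrite // /G2_lt; split=> //; clear -im m3; lia.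
pose k := (m + 3)./2; have km : 2 * k = m + 3 by rewrite /k; clear -om; lia.
exists k; first by clear -km m3; lia.
apply: (critical_iso Gc (f := fun u : G2 k => F (G2_index u))).
- exact: G2_not_tricolorable m3 km.
- move=> u v E; apply: G2_index_inj; have := G2_index_lt u; have := G2_index_lt v.
  have -> : 2 * k + 2 = m + 5 by rewrite km -addnA.
  move=> vm um; case: (ltngtP (G2_index u) (G2_index v)) => // lt.
    by have [] := FP _ _ lt vm; rewrite E eqxx.
  by have [] := FP _ _ lt um; rewrite E eqxx.
move=> u v; have := G2_index_lt u; have := G2_index_lt v.
have -> : 2 * k + 2 = m + 5 by rewrite km -addnA.
move=> vm um; case: (ltngtP (G2_index u) (G2_index v)) => lt.
- by have [_ ->] := FP _ _ lt vm; rewrite (G2_adjE m3 km).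
- by rewrite adjC; have [_ ->] := FP _ _ lt um; rewrite adjC (G2_adjE m3 km).
by rewrite (G2_index_inj lt) !adj_irr.
Qed.

End OddBranches.

(** * Both directions *)

Section Terms.
Variable S : nat -> nat.
Hypotheses (S0 : S 0 = 1) (S1 : S 1 = 3) (S2 : S 2 = 3).

Lemma catalogue_critical p : p \in catalogue ->
  vertex_critical4 S (edges_graph p.1 p.2).
Proof.
move/(allP catalogue_ok)=> /and3P[/fin_not_tricolorableP n3].
move=> /fin_colorable4P[w [c [c3 cw cP]]] /fin_del_tricolorableP dc.
exact: (critical4I S0 S1 S2 n3 (colorable4_once S0 S1 S2 c3 cw cP) dc).
Qed.

Lemma cycle_critical n : 4 < n ->
  [\/ n = 1 %[mod 4], n = 2 %[mod 4] | n = 3 %[mod 4] /\ S 3 < n %/ 2] ->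
  vertex_critical4 S (cycle_graph n).
Proof.
move=> n4 nmod; apply: (critical4I S0 S1 S2); last exact: cycle_del_tricolorable.
  apply: cyc_not_tricolorable (cycle_cyc_vertex n4) n4 _.
  by rewrite /dvdn; case: nmod => [->|->|[->]].
case: nmod => [E|E|[E s4]].
- by apply: cycle_colorable4_12; rewrite // E.
- by apply: cycle_colorable4_12; rewrite // E.
exact: cycle_colorable4_3.
Qed.

Lemma G2_critical k : 2 < k -> vertex_critical4 S (G2 k).
Proof.
move=> k3; have m3 : 2 < 2 * k - 3 by lia.
have km : 2 * k = 2 * k - 3 + 3 by lia.
apply: (critical4I S0 S1 S2).
- exact: G2_not_tricolorable m3 km.
- exact: G2_colorable4 m3 km _ S0 S1 S2.
exact: G2_del_tricolorable m3 km.
Qed.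

Lemma listed_critical (G : sgraph) : listed (S 3) G -> vertex_critical4 S G.
Proof.
have cat p : p \in catalogue -> graph_iso G (edges_graph p.1 p.2) ->
    vertex_critical4 S G.
  by move=> pc Gi; apply: critical4_iso Gi (catalogue_critical pc).
have nth_cat i : i < size catalogue ->
    graph_iso G (edges_graph (nth (0, [::]) catalogue i).1
                             (nth (0, [::]) catalogue i).2) ->
    vertex_critical4 S G by move=> ic; apply: cat; apply: mem_nth.
case=> [Gi|]; first exact: (nth_cat 0 isT Gi).
case=> [[[Gi|Gi|Gi|Gi]|Gi|Gi|[Gi|Gi]]|].
- exact: (nth_cat 1 isT Gi).
- exact: (nth_cat 2 isT Gi).
- exact: (nth_cat 3 isT Gi).
- exact: (nth_cat 4 isT Gi).
- exact: (nth_cat 5 isT Gi).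
- exact: (nth_cat 6 isT Gi).
- exact: (nth_cat 7 isT Gi).
- exact: (nth_cat 8 isT Gi).
case=> [[Gi|Gi|Gi|Gi]|].
- exact: (nth_cat 9 isT Gi).
- exact: (nth_cat 10 isT Gi).
- exact: (nth_cat 11 isT Gi).
- exact: (nth_cat 12 isT Gi).
case=> [[ch [n0 /subseqP[msk]]]|].
  case: msk => [|a [|b [|d []]]] // _ chE Gi; apply: (cat (6, cycle_edges 6 ++ ch)) Gi.
  by move: n0; rewrite chE; case: a {chE}; case: b; case: d.
case=> [[n [n4 nmod Gi]]|[k k3 Gi]].
  exact: critical4_iso Gi (cycle_critical n4 nmod).
exact: critical4_iso Gi (G2_critical k3).
Qed.

Lemma critical_listed (G : sgraph) : vertex_critical4 S G -> listed (S 3) G.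
Proof.
move=> /critical4P[n3 c4 dc].
have Gc : critical133 G.
  split=> [|u]; first by move/(tricolorableP S0 S1 S2).
  exact/(tricolorableP S0 S1 S2).
have [/existsP[a /existsP[b /existsP[c /and3P[ab bc ac]]]]|nt] :=
    boolP [exists a : G, exists b : G, exists c : G, [&& adj a b, adj b c & adj a c]].
  exact: (triangle_listed _ Gc ab bc ac).
have triangle_free (a b c : G) : adj b a -> adj b c -> adj a c = false.
  move=> ba bc; apply: contraNF nt => ac; apply/existsP; exists a.
  by apply/existsP; exists b; apply/existsP; exists c; rewrite adjC ba bc.
have [/existsP[x /existsP[y /and3P[bx by_ xy]]]|nb] :=
    boolP [exists x : G, exists y : G, [&& branch x, branch y & adj x y]].
  exact: (branch_edge_listed _ Gc triangle_free bx by_ xy).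
have branch_nadj (u v : G) : branch u -> branch v -> ~~ adj u v.
  move=> bu bv; apply: contra nb => uv; apply/existsP; exists u.
  by apply/existsP; exists v; rewrite bu bv.
case: (classic (exists n (f : nat -> G), [/\ 2 < n, cyc n f & ~~ (4 %| n)])).
  case=> n [f [n2 fc n4]]; have n5 : 4 < n.
    case: (ltngtP n 4) => // [n4'|nE]; last by rewrite nE in n4.
    have {n2 n4 n4'} nE : n = 3 by lia.
    rewrite nE in fc; have := fc.1 0 isT; have := fc.1 1 isT; have := fc.1 2 isT.
    rewrite /= => f20 f12 f01; have := triangle_free (f 0) (f 1) (f 2).
    by rewrite adjC f01 f12 adjC f20 => /(_ isT isT).
  have Gi := cyc_critical_iso branch_nadj Gc fc n5 n4.
  do 4!right; left; exists n; split=> //.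
  have c4n := colorable_iso Gi c4; have bound := cycle_colorable4_bound S0 S1 S2 n5 _ c4n.
  move: n4 bound; rewrite /dvdn; have := ltn_pmod n (isT : 0 < 4).
  case E : (n %% 4) => [|[|[|[|]]]] // _ _ bound.
  - exact: Or31.
  - exact: Or32.
  by apply: Or33; split=> //; apply: bound.
move=> no_cyc; have cyc4 n (f : nat -> G) : 2 < n -> cyc n f -> 4 %| n.
  by move=> n2 fc; apply: contraT => n4; case: no_cyc; exists n, f.
have [r0 _] : exists r : G, true.
  case: (pickP (@predT G)) => [r _|no]; first by exists r.
  by case: Gc.1; exists (fun=> 0) => // u; have := no u.
pose r := odflt r0 [pick v | branch v].
have rb (v : G) : branch v -> branch r.
  by rewrite /r; case: pickP => //= no; rewrite no.
have [lev [par [lev_r lev0 parP levS]]] := bfs (fun v => critical_connected Gc r v).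
have side := adj_odd lev_r lev0 parP levS cyc4.
have [/existsP[v /andP[bv ov]]|nov] := boolP [exists v : G, branch v && odd (lev v)].
  have [n vr] := critical_connected Gc r v.
  do 5!right; apply: (odd_branches_G2 side Gc cyc4 branch_nadj _ bv (rb _ bv) vr).
  by rewrite (walk_side side vr) ov lev_r.
case: Gc.1; apply: (levels_tricolorable lev_r lev0 parP levS cyc4) => v bv.
by apply: contra nov => ov; apply/existsP; exists v; rewrite bv.
Qed.

End Terms.

Theorem corollary3p17 (S : nat -> nat) (hS : packing_sequence S)
    (s1 : S 0 = 1) (s2 : S 1 = 3) (s3 : S 2 = 3) (G : sgraph) :
  vertex_critical4 S G <->
    graph_iso G (complete_graph 4) \/ in_H_family G \/ in_C5_family G \/
    in_C6_family G \/ in_D_family (S 3) G \/ in_G2_family G.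
Proof.
split; first exact: critical_listed.
exact: listed_critical.
Qed.
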